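(* Let $P$ be a grid polygon, and let $c$ be a cycle of size $m$ in the billiards permutation $\pi_P$. Then the trajectory $\operatorname{traj}(c)$ intersects at most $m-2$ triangular trajectories of $P$ (excluding $\operatorname{traj}(c)$ itself if $m=3$).
   Context: Consider the infinite triangular grid in the plane, scaled so that each equilateral triangular grid cell has side length $1$ and oriented so that some of the grid lines are horizontal. The sides of the grid cells are called panes. A grid polygon is a (not necessarily convex) polygon (the closed region, including its boundary) whose boundary is a union of panes; the boundary, viewed as a closed curve, does not intersect itself. Let $P$ be a grid polygon with boundary panes $b_1,\ldots,b_n$, listed clockwise. From the midpoint of a boundary pane $b_i$, emit a beam of light into the interior of $P$ so that the beam forms a $60^\circ$ angle with $b_i$ and travels either northeast (direction $60^\circ$), southeast (direction $-60^\circ$), or west (direction $180^\circ$), depending on the orientation of $b_i$ (exactly one of these three directions satisfies the requirements). The beam travels in a straight line through the interior of $P$ until reaching the midpoint of a different boundary pane $b_{\pi(i)}$, which it meets at a $60^\circ$ angle. This defines a permutation $\pi=\pi_P\colon[n]\to[n]$, where $[n]=\{1,\ldots,n\}$, called the billiards permutation of $P$. For points $p,p'$ in the plane, $[p,p']$ is the line segment with endpoints $p,p'$, and $\operatorname{mid}(s)$ is the midpoint of a segment $s$. If $c=(i_1\,i_2\cdots i_r)$ is a cycle of $\pi_P$, its trajectory is $\operatorname{traj}(c)=\bigcup_{j=1}^r[\operatorname{mid}(b_{i_j}),\operatorname{mid}(b_{\pi(i_j)})]$. A triangular trajectory of $P$ is the trajectory of a $3$-cycle of $\pi_P$. Two trajectories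 intersect if they have a point in common. *)

(* Defs.v *)
From HB Require Import structures.
From mathcomp Require Import all_boot all_order all_algebra all_fingroup.
From mathcomp Require Import all_classical all_reals all_analysis.

Set Implicit Arguments.
Unset Strict Implicit.
Unset Printing Implicit Defensive.

Import Order.TTheory GRing.Theory Num.Theory.
Import numFieldNormedType.Exports.

Local Open Scope classical_set_scope.
Local Open Scope ring_scope.

Section Plane.
Variable R : realType.

(* The library norm on R * R is the sup norm (which induces the usual topology
   of the plane), so the Euclidean length is defined separately. *)
Definition dot (u v : R * R) : R := u.1 * v.1 + u.2 * v.2.
Definition elength (u : R * R) : R := Num.sqrt (dot u u).

Definition segment (p q : R * R) : set (R * R) :=
  [set (1 - t) *: p + t *: q | t in `[0, 1]].
Definition midpoint (p q : R * R) : R * R := 2^-1 *: (p + q).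

(* u rotated by -90 degrees. *)
Definition right_normal (u : R * R) : R * R := (u.2, - u.1).

(* The lines directed by u and v form a 60 degree angle (cos 60 = 1/2). *)
Definition angle60 (u v : R * R) : Prop :=
  `|dot u v| = 2^-1 * (elength u * elength v).

Definition northeast : R * R := (2^-1, Num.sqrt 3 / 2).
Definition southeast : R * R := (2^-1, - (Num.sqrt 3 / 2)).
Definition west : R * R := (-1, 0).

(* A vertex of the triangular grid is given by its integer coordinates in the
   basis (1, 0), (1/2, sqrt 3 / 2). *)
Definition grid_point (a : int * int) : R * R :=
  (a.1%:~R + a.2%:~R / 2, a.2%:~R * (Num.sqrt 3 / 2)).

End Plane.

(* The six integer vectors are those whose image by grid_point has length 1. *)
Definition grid_adjacent (a b : int * int) : bool :=
  b - a \in [:: (1, 0); (0, 1); (-1, 1); (-1, 0); (0, -1); (1, -1)].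

(* A closed region whose topological boundary is a simple closed curve made of
   panes.  The vertices of the curve are listed clockwise, that is, with the
   interior of the region on the right; the pane of index i joins vertex i to
   the cyclically next one.  Two panes meet at most at a common endpoint, so the
   curve does not intersect itself iff its vertices are pairwise distinct. *)
Record grid_polygon (R : realType) := GridPolygon {
  region : set (R * R);
  npanes : nat;
  vertex : 'I_npanes -> int * int;
  npanes_ge3 : (3 <= npanes)%N;
  vertex_inj : injective vertex;
  vertex_adjacent : forall i, grid_adjacent (vertex i) (vertex (ordS i));
  region_compact : compact region;
  region_regular : region = closure region°;
  region_boundary : region `\` region° =
    \bigcup_(i in [set: 'I_npanes])
      segment (grid_point R (vertex i)) (grid_point R (vertex (ordS i)));
  region_clockwise : forall i,
    let p := grid_point R (vertex i) in
    let q := grid_point R (vertex (ordS i)) in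
    \forall t \near 0^'+, region° (midpoint p q + t *: right_normal (q - p))
}.

Section Billiards.
Variables (R : realType) (P : grid_polygon R).
Notation pane := 'I_(npanes P).

Definition pane_start (i : pane) : R * R := grid_point R (vertex i).
Definition pane_end (i : pane) : R * R := grid_point R (vertex (ordS i)).
Definition pane_vector (i : pane) : R * R := pane_end i - pane_start i.
Definition pane_mid (i : pane) : R * R := midpoint (pane_start i) (pane_end i).

Definition beam_direction (i : pane) (d : R * R) : Prop :=
  [/\ d = northeast R \/ d = southeast R \/ d = west R,
      angle60 d (pane_vector i)
    & \forall t \near 0^'+, (region P)° (pane_mid i + t *: d)].

Definition beam (i j : pane) : Prop :=
  exists d, beam_direction i d /\
  exists t : R,
    [/\ j != i, 0 < t, pane_mid j = pane_mid i + t *: d,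
        forall s : R, 0 < s < t -> (region P)° (pane_mid i + s *: d)
      & angle60 d (pane_vector j)].

(* The beam leaving a pane hits the boundary at a single first point, so at most
   one permutation satisfies this. *)
Definition billiards_permutation (sigma : {perm pane}) : Prop :=
  forall i, beam i (sigma i).

(* Cycles of sigma are represented by their supports, the elements of
   porbits sigma. *)
Definition trajectory (sigma : {perm pane}) (c : {set pane}) : set (R * R) :=
  \bigcup_(i in [set` c]) segment (pane_mid i) (pane_mid (sigma i)).

Definition triangular_trajectory (sigma : {perm pane}) (T : set (R * R)) : Prop :=
  exists c : {set pane},
    [/\ c \in porbits sigma, #|c| = 3%N & T = trajectory sigma c].

End Billiards.

(* Main.v *)
Require Import Defs.
From HB Require Import structures.
From mathcomp Require Import all_boot all_order all_algebra all_fingroup.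
From mathcomp Require Import all_classical all_reals all_analysis.
From mathcomp Require Import zify ring lra.

Set Implicit Arguments.
Unset Strict Implicit.
Unset Printing Implicit Defensive.

(** Why the theorem holds.

    Beams run in three directions whose vectors sum to zero, so at each pane a
    trajectory turns by 120 degrees to the left or to the right.  A triangular
    trajectory T turns three times to the same side; its three tips on the
    boundary cut the circle of panes into three arcs, one behind each side of T.
    A beam that crosses T enters and leaves through two sides that depend only on
    its direction, and all crossings move one step round the three arcs in the
    same rotational sense.  As c closes up, it visits all three arcs as soon as it
    crosses T ([crossing_visits]): each crossed T splits the m panes of c into
    three nonempty arcs.

    Two triangles that do not meet give noncrossing tripartitions, and there are
    at most m - 2 pairwise noncrossing tripartitions of m points on a circle, as in
    a triangulation of an m-gon.  The count used here is explicit.  Read the panes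
    of c from the first one, r; the other m - 1 panes have m - 2 gaps between
    consecutive ones.  Send T to the gap where one passes from one to the other of
    the two arcs of T that avoid r.  Triangles that do not meet never share a gap
    ([gap_compatible]).

    Two triangles that do meet turn to opposite sides and form a six-pointed star,
    and each triangle meets at most one other ([meets_opposite], [meets_unique]).
    If c crosses both, it goes round their arcs in opposite senses, hence visits
    at least four of the regions of the star ([crossing_pair_splits]), and the
    star has two distinct gaps to offer ([second_gap]).

    The geometry enters only through three facts about the side of a beam, defined
    combinatorially: the panes on the left of the beam from i to sigma i are those
    met clockwise between i and sigma i.  A beam passes from one side of another
    beam to the other only in the sense imposed by their directions
    ([beams_monotone]); after a left turn a beam ends on the left of its
    predecessor, and after a right turn on its right ([beams_turn]); beams whose
    segments meet separate each other's ends ([segments_cross]).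

    To prove them, refine the grid by a factor 2, so that beams and boundary become
    lattice paths, and consider the closed path formed by a beam and the boundary
    from its end back to its start.  Its winding number is a function of the cells
    that changes exactly across this path.  A function of the cells that
    vanishes inside P and changes only across the boundary is zero
    ([vanishes_outside]): its jump is constant along the boundary because the
    boundary is a single cycle, so it differs from a multiple of the indicator of P
    by a constant.  Hence the winding number vanishes outside P, and its value just
    inside a pane tells on which side of the beam the pane lies.  Walking along the
    left edge of a second beam, the winding number changes only where the two beams
    cross, by a sign that depends only on their directions. *)

(** * Directions and clockwise arcs *)

Inductive dir := NE | West | SE.

Definition dir_eqb d e :=
  match d, e with NE, NE | West, West | SE, SE => true | _, _ => false end.

Lemma dir_eqP : Equality.axiom dir_eqb.
Proof. by case; case; constructor. Qed.

HB.instance Definition _ := hasDecEq.Build dir dir_eqP.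

(** Turning by 120 degrees to the left and to the right. *)
Definition turnl d := match d with NE => West | West => SE | SE => NE end.
Definition turnr d := match d with NE => SE | SE => West | West => NE end.

(** Panes are numbered clockwise; the arc is open and empty when i = j. *)
Definition arc (i j x : nat) : bool :=
  (i < x < j) || (j < i) && ((i < x) || (x < j)).

(** The tips of a triangular trajectory are named by the direction of the beam
    that starts there; whichever way the triangle turns, this is their cyclic
    order on the boundary. *)
Definition clockwise (p : dir -> nat) : bool := arc (p NE) (p West) (p SE).

(** The arcs cut out by three tips, each named by the tip where it starts. *)
Definition reg (p : dir -> nat) (x : nat) : dir :=
  if arc (p NE) (p SE) x then NE else if arc (p SE) (p West) x then SE else West.

Lemma regP (p : dir -> nat) x d : clockwise p -> (forall e, x <> p e) ->
  reg p x = d <-> arc (p d) (p (turnr d)) x.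
Proof.
move=> cp xp; have := (xp NE, xp SE, xp West); move: cp; rewrite /clockwise /reg.
case: (boolP (arc (p NE) (p SE) x)) => h1; last case: (boolP (arc (p SE) (p West) x)) => h2.
all: move=> cp [[? ?] ?]; move: cp h1; try move: h2; rewrite /arc.
all: by case: d => /= *; split; intros; (done || lia || (exfalso; lia)).
Qed.

(** When the three points q lie in the arc from p0 to p1, the three points p all lie
    in the one arc of q that contains p0, and these two arcs cover the circle. *)
Lemma arc_nested (p0 p1 p2 q0 q1 q2 : nat) :
  p0 <> q0 -> p0 <> q1 -> p0 <> q2 ->
  arc p0 p2 p1 -> arc q0 q2 q1 ->
  arc p0 p1 q0 -> arc p0 p1 q1 -> arc p0 p1 q2 -> arc q0 q1 p0 ->
  [/\ arc q0 q1 p1, arc q0 q1 p2 & forall x, x <> p0 -> x <> p1 -> x <> q0 -> x <> q1 ->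
     arc p0 p1 x || arc q0 q1 x].
Proof.
rewrite /arc => n1 n2 n3 c1 c2 h1 h2 h3 h4.
case: (ltngtP p0 p1) c1 h1 h2 h3 => //= e; rewrite ?andbF ?andbT ?orbF ?andFb ?orFb => c1 h1 h2 h3;
case: (ltngtP q0 q1) c2 h4 => //= e'; rewrite ?andbF ?andbT ?orbF ?andFb ?orFb => c2 h4.
all: split; [lia|lia|move=> x; lia].
Qed.

Lemma clockwise_rot (p : dir -> nat) a :
  clockwise p -> arc (p a) (p (turnl a)) (p (turnr a)).
Proof. by rewrite /clockwise /arc; case: a => //= ?; lia. Qed.

(** Of two triangles neither of which separates the tips of the other, each lies in
    a single arc of the other, and each pane lies in one of these two arcs. *)
Lemma reg_outside (p q : dir -> nat) a :
  clockwise p -> clockwise q -> (forall d e, p d <> q e) ->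
  (forall d, reg p (q d) = a) ->
  exists b, (forall d, reg q (p d) = b) /\
    forall x, (forall e, x <> p e) -> (forall e, x <> q e) ->
      reg p x = a \/ reg q x = b.
Proof.
move=> cp cq dpq rq; exists (reg q (p a)).
have qp e d : q e <> p d by move=> /esym; apply: dpq.
have rP d : arc (p a) (p (turnr a)) (q d) by apply/regP.
set b := reg q (p a).
have bP : arc (q b) (q (turnr b)) (p a) by apply/regP.
have [h1 h2 h3] := arc_nested (dpq a b) (dpq a (turnr b)) (dpq a (turnl b))
  (clockwise_rot a cp) (clockwise_rot b cq) (rP b) (rP (turnr b)) (rP (turnl b)) bP.
split=> [d|x xp xq].
  by apply/regP => //; move: bP h1 h2; case: (a); case: d.
by case/orP: (h3 x (xp _) (xp _) (xq _) (xq _)) => ax; [left | right]; apply/regP.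
Qed.

Lemma tip_notin_arc (p : dir -> nat) a d : clockwise p ->
  ~~ arc (p a) (p (turnr a)) (p d).
Proof. by rewrite /clockwise /arc; case: a; case: d => /= ?; lia. Qed.

Lemma arc_convex (i j r x z y : nat) :
  x <> i -> x <> j -> y <> i -> y <> j -> r <= x -> x < z -> z < y ->
  arc i j r -> arc i j z -> arc i j x || arc i j y.
Proof. by rewrite /arc; lia. Qed.

Lemma arc_inner_half (i j r x z y : nat) : y <> i -> y <> j ->
  r <= x -> x < z -> z < y ->
  arc i j r -> arc i j z -> arc i j x -> ~~ arc i j y ->
  forall w, ~~ arc i j w -> w < r \/ z < w.
Proof. by rewrite /arc => *; lia. Qed.

Lemma arc_outer_half (i j r x z y : nat) : x <> i -> x <> j ->
  r <= x -> x < z -> z < y ->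
  arc i j r -> arc i j z -> arc i j y -> ~~ arc i j x ->
  forall w, w < r \/ z < w -> arc i j w.
Proof. by rewrite /arc => *; lia. Qed.

(** Here r and z share an arc of p, which is therefore a contiguous block containing
    one of the two ways round from r to z, hence x or y. *)
Section Regions.
Variables (p : dir -> nat) (r x z y : nat).
Hypotheses (cp : clockwise p) (rx : r <= x) (xz : x < z) (zy : z < y).
Hypotheses (rp : forall e, r <> p e) (xp : forall e, x <> p e)
  (zp : forall e, z <> p e) (yp : forall e, y <> p e).
Hypothesis ez : reg p z = reg p r.

Let a := reg p r.
Let rP : arc (p a) (p (turnr a)) r. Proof. exact/regP. Qed.
Let zP : arc (p a) (p (turnr a)) z. Proof. exact/regP. Qed.

Lemma reg_convex : reg p x = reg p r \/ reg p y = reg p r.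
Proof.
by case/orP: (arc_convex (@xp _) (@xp _) (@yp _) (@yp _) rx xz zy rP zP) => h;
  [left | right]; apply/regP.
Qed.

(** If the shared arc goes from r to z through x but not on to y, the tips are on the
    other way round. *)
Lemma reg_tips_beyond : reg p x = reg p r -> reg p y <> reg p r ->
  forall d, p d < r \/ z < p d.
Proof.
move=> ex ey d; have xP : arc (p a) (p (turnr a)) x by apply/regP.
have yP : ~~ arc (p a) (p (turnr a)) y by apply/negP => h; apply: ey; apply/regP.
exact: (arc_inner_half (@yp _) (@yp _) rx xz zy rP zP xP yP) (tip_notin_arc _ _ cp).
Qed.

(** If the shared arc goes from r to z through y but avoids x, it contains the whole
    other way round. *)
Lemma reg_beyond w : (forall e, w <> p e) -> reg p y = reg p r ->
  reg p x <> reg p r -> w < r \/ z < w -> reg p w = reg p r.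
Proof.
move=> wp ey ex hw; have yP : arc (p a) (p (turnr a)) y by apply/regP.
have xP : ~~ arc (p a) (p (turnr a)) x by apply/negP => h; apply: ex; apply/regP.
by apply/regP => //; exact: (arc_outer_half (@xp _) (@xp _) rx xz zy rP zP yP xP).
Qed.

End Regions.

(** The boundary from i to sigma i, taken clockwise, is the part of the boundary on
    the left of the beam. *)
Definition left n (sigma : {perm 'I_n}) (i x : 'I_n) : bool := arc i (sigma i) x.

(** A beam can cross another one only towards the side that its direction points
    to. *)
Definition monotone_sides n (sigma : {perm 'I_n}) (ty : 'I_n -> dir) :=
  forall i u, u != i -> u != sigma i -> sigma u != i ->
  [/\ ty u = ty i -> left sigma i (sigma u) = left sigma i u,
      ty u = turnl (ty i) -> left sigma i u -> left sigma i (sigma u)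
    & ty u = turnr (ty i) -> left sigma i (sigma u) -> left sigma i u].

Definition turns_to_its_side n (sigma : {perm 'I_n}) (ty : 'I_n -> dir) :=
  forall i, sigma (sigma i) != i ->
  ty (sigma i) = turnl (ty i) /\ left sigma i (sigma (sigma i)) \/
  ty (sigma i) = turnr (ty i) /\ ~~ left sigma i (sigma (sigma i)).

(** * Gaps between consecutive elements of a labelled set *)
Section Gaps.
Variable n : nat.
Variables (c : {set 'I_n}) (r : 'I_n).
Hypothesis rc : r \in c.

(** Cyclically, the elements labelled like r are contiguous; r being the least
    element, the others form a block of consecutive elements. *)
Definition convex_labels (L : eqType) (lab : 'I_n -> L) := forall x z y,
  x \in c -> z \in c -> y \in c -> x < z -> z < y -> lab z = lab r ->
  lab x = lab r \/ lab y = lab r.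

(** A gap is represented by its left end x; y is the next element of c. *)
Definition gap (L : eqType) (lab : 'I_n -> L) (x : 'I_n) := x \in c /\ exists y,
  [/\ y \in c, x < y, forall z, z \in c -> x < z -> y <= z & [/\ lab x != lab y,
   lab x != lab r & lab y != lab r]].

(** Take for x the last element before x2 whose label is not that of x2. *)
Lemma gap_between (L : eqType) (lab : 'I_n -> L) x1 x2 : convex_labels lab ->
  x1 \in c -> x2 \in c -> x1 < x2 -> lab x1 != lab x2 -> lab x1 != lab r -> lab x2 != lab r ->
  exists x, [/\ gap lab x, x1 <= x & x < x2].
Proof.
move=> conv x1c x2c x12 n12 n1 n2.
pose P z := [&& z \in c, z < x2 & lab z != lab x2].
have P1 : P x1 by rewrite /P x1c x12.
case: (arg_maxnP (fun z : 'I_n => z : nat) P1) => x /and3P[xc xx2 nx] xmax.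
pose Q z := (z \in c) && (x < z).
have Q2 : Q x2 by rewrite /Q x2c.
case: (arg_minnP (fun z : 'I_n => z : nat) Q2) => y /andP[yc xy] ymin.
have x1x : x1 <= x := xmax x1 P1.
have labr z : z \in c -> x1 <= z -> z <= x2 -> lab z != lab r.
  move=> zc h1 h2; apply/eqP => e.
  have [e1|l1] := eqVneq x1 z; first by move: n1; rewrite e1 e eqxx.
  have [e2|l2] := eqVneq z x2; first by move: n2; rewrite -e2 e eqxx.
  have zx : x1 < z < x2 by rewrite !ltn_neqAle !val_eqE l1 l2 h1 h2.
  case/andP: zx => zx1 zx2.
  by case: (conv x1 z x2 x1c zc x2c zx1 zx2 e) => /eqP; apply/negP.
have yx2 : y <= x2 by apply: ymin.
exists x; split=> //; split=> //; exists y; split=> //.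
  by move=> z zc xz; apply: ymin; rewrite /Q zc.
have x1y : x1 <= y := leq_trans x1x (ltnW xy).
split; [|exact: labr xc x1x (ltnW xx2)|exact: labr].
have [->//|ny] := eqVneq y x2.
have ly : y < x2 by rewrite ltn_neqAle val_eqE ny.
have -> // : lab y = lab x2.
apply/eqP/negPn/negP => h; have := xmax y; rewrite /P yc ly h => /(_ isT).
by rewrite /= leqNgt xy.
Qed.

Lemma gap_map (L L' : eqType) (f : L -> L') (lab : 'I_n -> L) x :
  gap (f \o lab) x -> gap lab x.
Proof.
case=> xc [y [yc xy nz [h1 h2 h3]]]; split=> //; exists y; split=> //.
by split; [move: h1|move: h2|move: h3]; apply: contra => /eqP /= ->.
Qed.

(** The label of r is lab r = a or lab' r = b.  In the first case both ends of the
    gap have a label other than a, hence the same second label b; the other case is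
    symmetric. *)
Lemma gap_compatible (L L' : eqType) (lab : 'I_n -> L) (lab' : 'I_n -> L') a b x :
  (forall z, z \in c -> lab z = a \/ lab' z = b) -> gap lab x -> gap lab' x -> False.
Proof.
move=> cmp [xc [y [yc xy ymin [h1 h2 h3]]]] [_ [y' [y'c xy' y'min [h1' h2' h3']]]].
have e : y' = y by apply/val_inj/eqP; rewrite eqn_leq ymin ?y'min.
rewrite e in h1' h3'.
move: h1 h2 h3 h1' h2' h3'.
by case: (cmp _ xc) => ->; case: (cmp _ yc) => ->; case: (cmp _ rc) => ->;
  rewrite ?eqxx.
Qed.

Lemma gap_of_two (L : eqType) (lab : 'I_n -> L) y z : convex_labels lab ->
  y \in c -> z \in c -> lab y != lab z -> lab y != lab r -> lab z != lab r ->
  exists x, gap lab x /\ (y <= x < z \/ z <= x < y).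
Proof.
move=> conv yc zc yz yr zr.
have [l|l|e] := ltngtP y z; last by move: yz; rewrite (val_inj e) eqxx.
  have [x [gx h1 h2]] := gap_between conv yc zc l yz yr zr.
  by exists x; split=> //; left; rewrite h1.
rewrite eq_sym in yz; have [x [gx h1 h2]] := gap_between conv zc yc l yz zr yr.
by exists x; split=> //; right; rewrite h1.
Qed.

(** At most one of four distinct labels is that of r, and two of the three
    remaining elements lie on the same side of x0. *)
Lemma second_gap (L : eqType) (lab : 'I_n -> L) (s : seq 'I_n) (x0 : 'I_n) :
  convex_labels lab -> {subset s <= c} -> uniq (map lab s) -> 3 < size s ->
  exists x, gap lab x /\ x != x0.
Proof.
move=> conv sc us s4.
have [y0 [y1 [y2 [h0 h1 h2 hu]]]] : exists y0 y1 y2, [/\ y0 \in c /\ lab y0 != lab r,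
    y1 \in c /\ lab y1 != lab r, y2 \in c /\ lab y2 != lab r & uniq [:: lab y0; lab y1; lab y2]].
  have : 2 < size [seq y <- s | lab y != lab r].
    rewrite size_filter -ltnS; apply: leq_trans s4 _.
    rewrite -(count_predC (fun y => lab y != lab r) s) -addn1 leq_add2l.
    rewrite (eq_count (a2 := preim lab (pred1 (lab r)))); last by move=> y /=; rewrite negbK.
    by rewrite -count_map count_uniq_mem //; case: (_ \in _).
  have: uniq (map lab [seq y <- s | lab y != lab r]).
    by apply: subseq_uniq us; apply/map_subseq/filter_subseq.
  have: {subset [seq y <- s | lab y != lab r] <= [pred y | (y \in c) && (lab y != lab r)]}.
    by move=> y; rewrite mem_filter inE => /andP[-> /sc ->].
  case: [seq _ <- _ | _] => [|y0 [|y1 [|y2 ys]]] //= sub us' _.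
  exists y0, y1, y2; split.
  - by apply/andP/(sub y0); rewrite !inE eqxx.
  - by apply/andP/(sub y1); rewrite !inE eqxx ?orbT.
  - by apply/andP/(sub y2); rewrite !inE eqxx ?orbT.
  by move: us'; rewrite /= !inE !negb_or => /and4P[/and3P[-> -> _] /andP[-> _] _ _].
move: hu; rewrite /= !inE !negb_or !andbT => /andP[/andP[n01 n02] n12].
have pair y z : y \in c /\ lab y != lab r -> z \in c /\ lab z != lab r -> lab y != lab z ->
    (y <= x0) = (z <= x0) -> exists x, gap lab x /\ x != x0.
  move=> [yc yr] [zc zr] yz same.
  have [x [gx hx]] := gap_of_two conv yc zc yz yr zr; exists x; split=> //.
  by move: hx same; rewrite -val_eqE /=; clear; lia.
have [e|e] := eqVneq (y0 <= x0) (y1 <= x0); first exact: (pair y0 y1).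
have [e'|e'] := eqVneq (y0 <= x0) (y2 <= x0); first exact: (pair y0 y2).
by apply: (pair y1 y2) => //; move: e e'; do 3!case: (_ <= _).
Qed.
End Gaps.

(** * Triangles and the trajectories that cross them *)
Section Cycles.
Variables (n : nat) (sigma : {perm 'I_n}) (ty : 'I_n -> dir).

Local Notation left := (left sigma).
Hypotheses (side : monotone_sides sigma ty) (turn : turns_to_its_side sigma ty).

(** [t d] is the pane where the beam of direction d starts; the triangle turns left
    if s is true and right otherwise. *)
Definition triangle (s : bool) (t : dir -> 'I_n) :=
  forall d, ty (t d) = d /\ sigma (t d) = t (if s then turnl d else turnr d).

Definition region_of (t : dir -> 'I_n) (x : 'I_n) : dir := reg (fun d => t d : nat) x.

Definition off (t : dir -> 'I_n) (x : 'I_n) := forall d, x <> t d.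

(** The interior of a triangle is on the side to which it turns, so its third tip is
    on that side of each of its beams. *)
Lemma triangle_clockwise s t : triangle s t -> clockwise (fun d => t d : nat).
Proof.
move=> tt; have ne d e : d != e -> t d != t e.
  by apply: contra => /eqP ede; rewrite -(tt d).1 -(tt e).1 ede.
have h1 : (t NE : nat) <> t SE by apply/eqP; rewrite val_eqE ne.
have h2 : (t NE : nat) <> t West by apply/eqP; rewrite val_eqE ne.
have h3 : (t SE : nat) <> t West by apply/eqP; rewrite val_eqE ne.
have := turn (i := t NE); rewrite /left /clockwise /arc (tt NE).2 (tt NE).1.
case: s tt => tt; rewrite !(tt _).2 !(tt _).1 ne //= => /(_ isT) [] [] //.
by lia.
Qed.

Lemma off_nat t x : off t x -> forall e, (x : nat) <> t e.
Proof. by move=> xt e /val_inj/xt. Qed.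

(** The outer region behind the side of direction d is on the right of that side for
    a left-turning triangle, and on its left for a right-turning one. *)
Lemma left_side s t d x : triangle s t -> off t x ->
  left (t d) x = if s then region_of t x != turnl d else region_of t x == d.
Proof.
move=> tt xt; have ct := triangle_clockwise tt.
have rP e : (region_of t x == e) = arc (t e) (t (turnr e)) x.
  by apply/eqP/idP => /(regP _ ct (off_nat xt)).
rewrite !rP /left (tt d).2.
move: ct (@off_nat _ _ xt NE) (@off_nat _ _ xt SE) (@off_nat _ _ xt West).
by rewrite /clockwise /arc; case: s {tt}; case: d => /=; lia.
Qed.

(** A beam of a given direction can enter the triangle only through one of its sides
    and leave it only through another one. *)
Lemma region_step s t u : triangle s t -> off t u ->
  region_of t (sigma u) = region_of t u \/
  region_of t (sigma u) = turnr (ty u) /\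
  region_of t u = if s then ty u else turnl (ty u).
Proof.
move=> tt ut; have sut : off t (sigma u).
  move=> d e; have [d' ed] : exists d', t d = sigma (t d').
    by exists (if s then turnr d else turnl d); rewrite (tt _).2; case: (s); case: d {e}.
  by apply: (ut d'); apply: (@perm_inj _ sigma); rewrite e ed.
have sides d := side (i := t d) (u := u) (introN eqP (@ut d))
   (introN eqP (fun e => @ut _ (etrans e (tt d).2))) (introN eqP (@sut d)).
move: (sides NE) (sides West) (sides SE).
rewrite !(left_side _ tt) // !(tt _).1; clear.
case: s; case: (ty u); case: (region_of t u); case: (region_of t (sigma u)) => /=;
 by move=> [a1 a2 a3] [b1 b2 b3] [c1 c2 c3]; auto;
   try (have := a1 erefl); try (have := a2 erefl isT); try (have := a3 erefl isT);
   try (have := b1 erefl); try (have := b2 erefl isT); try (have := b3 erefl isT);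
   try (have := c1 erefl); try (have := c2 erefl isT); try (have := c3 erefl isT).
Qed.

Section Orbit.
Variable c : {set 'I_n}.
Hypothesis cP : c \in porbits sigma.

Lemma orbit_porbit x : x \in c -> c = porbit sigma x.
Proof. by case/imsetP: cP => z _ -> xz; apply/esym/eqP; rewrite eq_porbit_mem. Qed.

Lemma orbit_step x : x \in c -> sigma x \in c.
Proof. by move=> xc; rewrite (orbit_porbit xc) -{1}[sigma]expg1 mem_porbit. Qed.

Lemma orbit_ind (P : 'I_n -> Prop) x : x \in c -> P x ->
  (forall y, y \in c -> P y -> P (sigma y)) -> forall y, y \in c -> P y.
Proof.
move=> xc Px IH y; rewrite {1}(orbit_porbit xc) => /porbitP[k ->].
suff: (sigma ^+ k)%g x \in c /\ P ((sigma ^+ k)%g x) by case.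
elim: k => [|k [kc kP]]; first by rewrite expg0 perm1.
by rewrite expgSr permM; split; [exact: orbit_step | exact: IH].
Qed.

(** A closed walk on three labels that moves only by one rotation m, and does move,
    takes all three labels: if it stopped leaving some label, it would stay there
    for ever. *)
Lemma orbit_visits_all (m : dir -> dir) (f : 'I_n -> dir) u :
  m = turnl \/ m = turnr -> u \in c -> f (sigma u) <> f u ->
  (forall y, y \in c -> f (sigma y) = f y \/ f (sigma y) = m (f y)) ->
  forall d, exists y, [/\ y \in c, f y = d & f (sigma y) = m d].
Proof.
move=> mE uc nu st.
have leave y : y \in c -> exists z, [/\ z \in c, f z = f y & f (sigma z) = m (f y)].
  move=> yc; have [//|none] := pselect (exists z, [/\ z \in c, f z = f y & f (sigma z) = m (f y)]).
  have const : forall z, z \in c -> f z = f y.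
    apply: (orbit_ind yc) => // z zc zy; case: (st z zc) => [->//|e].
    by case: none; exists z; split=> //; rewrite e zy.
  by case: nu; rewrite !const // orbit_step.
have [y [yc fy fsy]] := leave u uc.
have [z [zc fz fsz]] := leave _ (orbit_step yc).
have [w [wc fw fsw]] := leave _ (orbit_step zc).
move=> d.
rewrite fsz fsy in fw fsw; rewrite fsy in fz fsz.
case: mE => mE; rewrite mE in fsy fz fsz fw fsw *.
all: case: (f u) fy fsy fz fsz fw fsw => /= *; case: d;
  solve [by exists y | by exists z | by exists w].
Qed.

Definition crosses (t : dir -> 'I_n) :=
  exists u d, u \in c /\ left (t d) u != left (t d) (sigma u).

Section Crossing.
Variables (s : bool) (t : dir -> 'I_n).
Hypotheses (tt : triangle s t) (ct : forall d, t d \notin c) (xt : crosses t).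

Lemma off_orbit y : y \in c -> off t y.
Proof. by move=> yc d e; move: yc; rewrite e (negbTE (ct d)). Qed.

Lemma crossing_visits d : exists y, [/\ y \in c, region_of t y = d &
  region_of t (sigma y) = if s then turnr d else turnl d].
Proof.
have [u [d' [uc nu]]] := xt.
have uo := off_orbit uc; have suo := off_orbit (orbit_step uc).
have nu' : region_of t (sigma u) <> region_of t u.
  by move=> e; move: nu; rewrite !(left_side _ tt) // e eqxx.
have [||y [yc <- ysy]] := @orbit_visits_all (if s then turnr else turnl) _ u _ uc nu' _ d.
- by case: (s); [right | left].
- move=> y yc; have [->|[-> ->]] := region_step tt (off_orbit yc); first by left.
  by right; case: (s); case: (ty y).
by exists y; rewrite ysy; case: (s).
Qed.
End Crossing.
End Orbit.

(** The sides of t separate the tips of t'. *)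
Definition meets (t t' : dir -> 'I_n) : bool :=
  ~~ ((region_of t (t' NE) == region_of t (t' West)) &&
      (region_of t (t' West) == region_of t (t' SE))).

Definition apart (t t' : dir -> 'I_n) (a b : dir) :=
  [/\ forall d, region_of t (t' d) = a, forall d, region_of t' (t d) = b &
      forall x, off t x -> off t' x -> region_of t x = a \/ region_of t' x = b].

Definition disjoint_tips (t t' : dir -> 'I_n) := forall d e, t d <> t' e.

Lemma not_meets_const t t' : ~~ meets t t' -> forall d, region_of t (t' d) = region_of t (t' NE).
Proof. by rewrite negbK => /andP[/eqP e1 /eqP e2] []; rewrite -?e2 -?e1. Qed.

Section Pair.
Variables (s s' : bool) (t t' : dir -> 'I_n).
Hypotheses (tt : triangle s t) (tt' : triangle s' t') (dj : disjoint_tips t t').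

Lemma tips_off d : off t (t' d).
Proof. by move=> e /esym; apply: dj. Qed.

(** The trajectory t' closes up after three beams, one in each direction.  If it turns
    like t, the order in which these directions come prevents it from going round
    the three regions of t; if it turns the other way and moves at all, it goes
    round them once. *)
Lemma meets_opposite : meets t t' ->
  s != s' /\ forall d e, region_of t (t' d) = region_of t (t' e) -> d = e.
Proof.
have st d := region_step tt (@tips_off d).
move: (st NE) (st West) (st SE); rewrite !(tt' _).1 !(tt' _).2 /meets; clear.
case E1: (region_of t (t' NE)); case E2: (region_of t (t' West));
  case E3: (region_of t (t' SE)) => //=; case: s; case: s' => //= h1 h2 h3 _.
all: move: h1 h2 h3; rewrite ?E1 ?E2 ?E3 => - [?|[? ?]] [?|[? ?]] [?|[? ?]] //.
all: by split=> // -[] []; rewrite ?E1 ?E2 ?E3.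
Qed.

Lemma not_meets_apart : ~~ meets t t' -> exists a b, apart t t' a b.
Proof.
move=> /not_meets_const m.
have dj' d e : (t d : nat) <> t' e by move/val_inj/dj.
have [b [e1 e2]] := reg_outside (triangle_clockwise tt) (triangle_clockwise tt') dj' m.
exists (region_of t (t' NE)), b; split=> // x xt xt'.
by apply: e2; apply: off_nat.
Qed.
End Pair.

Lemma apart_not_meets t t' a b : apart t t' a b -> ~~ meets t t'.
Proof. by case=> h _ _; rewrite /meets !h !eqxx. Qed.

Lemma apart_sym t t' a b : apart t t' a b -> apart t' t b a.
Proof. by case=> h1 h2 h3; split=> // x h h'; apply/or_comm; exact: h3. Qed.

Lemma meets_sym s s' t t' : triangle s t -> triangle s' t' -> disjoint_tips t t' ->
  meets t t' -> meets t' t.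
Proof.
move=> tt tt' dj; apply: contraLR => nm.
have [|a [b /apart_sym /apart_not_meets //]] := not_meets_apart tt' tt _ nm.
by move=> d e /esym; apply: dj.
Qed.

(** Two triangles that meet lie in the same region of any triangle that meets
    neither. *)
Lemma apart_linked t1 t2 u a1 b1 a2 b2 :
  disjoint_tips t1 t2 -> disjoint_tips t2 u -> meets t1 t2 ->
  apart t1 u a1 b1 -> apart t2 u a2 b2 -> b1 = b2.
Proof.
move=> d12 d2u m [_ _ h] [_ h2 _].
have hd d : region_of t1 (t2 d) = a1 \/ b1 = b2.
  rewrite -(h2 d); have [||->|->] := h (t2 d); [|by move=> e; apply: d2u|by left|by right].
  by move=> e /esym; apply: d12.
case: (hd NE) => // e1; case: (hd West) => // e2; case: (hd SE) => // e3.
by move: m; rewrite /meets e1 e2 e3 !eqxx.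
Qed.

(** Triangles t1 and t2 that both meet t turn the same way, so they do not meet.  Then
    each of the three tips of t lies in the region of t1 that contains t2 or in the
    region of t2 that contains t1; but each of these regions contains a single tip
    of t. *)
Lemma meets_unique s s1 s2 t t1 t2 : triangle s t -> triangle s1 t1 -> triangle s2 t2 ->
  disjoint_tips t t1 -> disjoint_tips t t2 -> disjoint_tips t1 t2 ->
  meets t1 t -> meets t2 t -> False.
Proof.
move=> tt tt1 tt2 d1 d2 d12 m1 m2.
have sy u v : disjoint_tips u v -> disjoint_tips v u by move=> h d e /esym; apply: h.
have [n1 i1] := meets_opposite tt1 tt (sy _ _ d1) m1.
have [n2 i2] := meets_opposite tt2 tt (sy _ _ d2) m2.
have nm : ~~ meets t1 t2.
  apply/negP => /(meets_opposite tt1 tt2 d12)[]; move: n1 n2.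
  by case: (s); case: (s1); case: (s2).
have [a [b [_ _ h]]] := not_meets_apart tt1 tt2 d12 nm.
have hd d : region_of t1 (t d) = a \/ region_of t2 (t d) = b.
  by apply: h => e; [apply: d1|apply: d2].
case: (hd NE) (hd West) (hd SE) => e1 [] e2 [] e3;
 try (by have := i1 NE West (etrans e1 (esym e2))); try (by have := i1 NE SE (etrans e1 (esym e3)));
 try (by have := i1 West SE (etrans e2 (esym e3)));
 try (by have := i2 NE West (etrans e1 (esym e2))); try (by have := i2 NE SE (etrans e1 (esym e3)));
 by have := i2 West SE (etrans e2 (esym e3)).
Qed.

Section CrossingPair.
Variables (c : {set 'I_n}) (t t' : dir -> 'I_n).
Hypotheses (cP : c \in porbits sigma).
Hypotheses (tt : triangle true t) (tt' : triangle false t').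
Hypotheses (ct : forall d, t d \notin c) (ct' : forall d, t' d \notin c).
Hypotheses (xt : crosses c t) (xt' : crosses c t').

(** Otherwise the region of t' would be a function of the region of t along c.  This
    function would be a bijection, since c visits all the regions of both triangles,
    so each step of c round t would be a step round t'.  The steps
    allowed by the direction of the beam then give two values to this function. *)
Lemma crossing_pair_splits : exists y z, [/\ y \in c, z \in c,
  region_of t y = region_of t z & region_of t' y <> region_of t' z].
Proof.
apply: contrapT => none.
have fn y z : y \in c -> z \in c -> region_of t y = region_of t z ->
    region_of t' y = region_of t' z.
  move=> yc zc e; apply: contrapT => ne; apply: none; by exists y, z.
have [y0 [y0c ay0 asy0]] := crossing_visits cP tt ct xt NE.
have [y1 [y1c ay1 asy1]] := crossing_visits cP tt ct xt West.
have [y2 [y2c ay2 asy2]] := crossing_visits cP tt ct xt SE.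
have step d y y' : [/\ y \in c, region_of t y = d & region_of t (sigma y) = turnr d] ->
    y' \in c -> region_of t y' = turnr d ->
    region_of t' y' = region_of t' y \/ region_of t' y' = turnr d /\ region_of t' y = turnl d.
  move=> [yc ay asy] y'c ay'.
  rewrite -(fn (sigma y) y') ?asy ?ay' ?(orbit_step cP) //.
  have := region_step tt (off_orbit ct yc); rewrite ay asy.
  case=> [e|[_ ->]]; first by case: (d) e.
  exact: region_step tt' (off_orbit ct' yc).
have [z0 [z0c bz0 _]] := crossing_visits cP tt' ct' xt' NE.
have [z1 [z1c bz1 _]] := crossing_visits cP tt' ct' xt' West.
have [z2 [z2c bz2 _]] := crossing_visits cP tt' ct' xt' SE.
have lab z : z \in c -> [\/ region_of t' z = region_of t' y0,
   region_of t' z = region_of t' y1 | region_of t' z = region_of t' y2].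
  by move=> zc; case e: (region_of t z); [constructor 1|constructor 2|constructor 3];
    apply: fn; rewrite ?e.
move: (lab z0 z0c) (lab z1 z1c) (lab z2 z2c); rewrite bz0 bz1 bz2.
move: (step NE y0 y2 (And3 y0c ay0 asy0) y2c ay2).
move: (step West y1 y0 (And3 y1c ay1 asy1) y0c ay0).
move: (step SE y2 y1 (And3 y2c ay2 asy2) y1c ay1).
case: (region_of t' y0); case: (region_of t' y1); case: (region_of t' y2) => /=.
all: by move=> [?|[? ?]] [?|[? ?]] [?|[? ?]] [] // _ [] // _ [].
Qed.
End CrossingPair.

(** * Counting the triangles crossed by a trajectory *)
Section Counting.
Variables (I : finType) (c : {set 'I_n}) (s : I -> bool) (t : I -> dir -> 'I_n).
Variable r : 'I_n.
Hypotheses (cP : c \in porbits sigma) (rc : r \in c).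
Hypothesis rmin : forall x, x \in c -> r <= x.
Hypotheses (tt : forall i, triangle (s i) (t i)) (ct : forall i d, t i d \notin c).
Hypotheses (xt : forall i, crosses c (t i)).
Hypothesis dj : forall i j, i != j -> disjoint_tips (t i) (t j).

Local Notation lab1 i := (region_of (t i)).

Lemma region_convex i : convex_labels c r (lab1 i).
Proof.
move=> x z y xc zc yc xz zy ez.
have o w : w \in c -> off (t i) w by apply: off_orbit.
by apply: (reg_convex (triangle_clockwise (tt i)) (rmin xc) xz zy) => //;
  apply: off_nat; apply: o.
Qed.

Definition lab2 i j x := (lab1 i x, lab1 j x).

(** The two arcs that contain r, one for each triangle of a star, have a contiguous
    intersection because they do not cover the circle. *)
Lemma lab2_convex i j : i != j -> meets (t i) (t j) -> convex_labels c r (lab2 i j).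
Proof.
move=> nij mij.
(* If x shares the region of r for the first triangle only, and y for the
   second only, then one of the two memberships extends. *)
suff half i' j' x z y : i' != j' -> meets (t i') (t j') ->
    x \in c -> z \in c -> y \in c -> x < z -> z < y ->
    lab1 i' z = lab1 i' r -> lab1 j' z = lab1 j' r ->
    lab1 i' x = lab1 i' r -> lab1 j' y = lab1 j' r ->
    lab1 i' y = lab1 i' r \/ lab1 j' x = lab1 j' r.
  move=> x z y xc zc yc xz zy [e1 e2].
  have [ix|iy] := region_convex xc zc yc xz zy e1;
    have [jx|jy] := region_convex xc zc yc xz zy e2;
    try (by left; rewrite /lab2 ix jx); try (by right; rewrite /lab2 iy jy).
    by have [e|e] := half _ _ _ _ _ nij mij xc zc yc xz zy e1 e2 ix jy;
      [right; rewrite /lab2 e jy | left; rewrite /lab2 ix e].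
  have mji := meets_sym (tt i) (tt j) (dj nij) mij; rewrite eq_sym in nij.
  by have [e|e] := half _ _ _ _ _ nij mji xc zc yc xz zy e2 e1 jx iy;
    [right; rewrite /lab2 iy e | left; rewrite /lab2 e jx].
move=> ij m xc zc yc xz zy ei ej ix jy.
have o k w : w \in c -> forall e, (w : nat) <> t k e by move=> wc; apply/off_nat/off_orbit.
have [|ny] := eqVneq (lab1 i' y) (lab1 i' r); first by left.
have [|nx] := eqVneq (lab1 j' x) (lab1 j' r); first by right.
have m' := meets_sym (tt i') (tt j') (dj ij) m; rewrite eq_sym in ij.
have bey := reg_tips_beyond (triangle_clockwise (tt i')) (rmin xc) xz zy
  (o _ _ rc) (o _ _ xc) (o _ _ zc) (o _ _ yc) ei ix (elimN eqP ny).
have const d : lab1 j' (t i' d) = lab1 j' r.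
  apply: (reg_beyond (triangle_clockwise (tt j')) (rmin xc) xz zy
    (o _ _ rc) (o _ _ xc) (o _ _ zc) (o _ _ yc) ej _ jy (elimN eqP nx) (bey d)).
  by move=> e /val_inj; apply: dj; rewrite eq_sym.
by move: m'; rewrite /meets !const !eqxx.
Qed.

(** The other triangle of the star of i, or i itself. *)
Definition partner i := odflt i [pick j | (i != j) && meets (t i) (t j)].

Lemma partnerP i : i = partner i /\ (forall j, i != j -> ~~ meets (t i) (t j)) \/
  i != partner i /\ meets (t i) (t (partner i)).
Proof.
rewrite /partner; case: pickP => [j /andP[ij m]|no] /=; first by right.
by left; split=> // j ij; move: (no j); rewrite ij => /= ->.
Qed.

Lemma partner_unique i j k : i != k -> j != k -> meets (t i) (t k) -> meets (t j) (t k) -> i = j.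
Proof.
move=> ik jk m1 m2; apply/eqP/negPn/negP => ij.
have ki : k != i by rewrite eq_sym.
have kj : k != j by rewrite eq_sym.
exact: (meets_unique (tt k) (tt i) (tt j) (dj ki) (dj kj) (dj ij)).
Qed.

Lemma meetsC i j : i != j -> meets (t i) (t j) -> meets (t j) (t i).
Proof. by move=> ij; apply: (meets_sym (tt i) (tt j) (dj ij)). Qed.

Local Notation lab i := (lab2 i (partner i)).

Lemma two_regions_gap i : exists x, gap c r (lab1 i) x.
Proof.
pose a := turnl (lab1 i r); pose b := turnr (lab1 i r).
have [y [yc ya _]] := crossing_visits cP (tt i) (@ct i) (xt i) a.
have [z [zc zb _]] := crossing_visits cP (tt i) (@ct i) (xt i) b.
have [|||x [gx _]] := gap_of_two (@region_convex i) yc zc.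
- by rewrite ya zb /a /b; case: (lab1 i r).
- by rewrite ya /a; case: (lab1 i r).
- by rewrite zb /b; case: (lab1 i r).
by exists x.
Qed.

(** c visits two regions of the star that differ only for one triangle, and the two
    other regions of the other triangle. *)
Lemma four_regions_gap i j x0 : s i = true -> s j = false -> meets (t j) (t i) ->
  exists x, gap c r (lab2 j i) x /\ x != x0.
Proof.
move=> si sj m; have ij : i != j by apply/eqP => e; move: si; rewrite e sj.
have ti := tt i; have tj := tt j; rewrite si in ti; rewrite sj in tj.
have [y [z [yc zc yz nyz]]] := crossing_pair_splits cP ti tj (@ct i) (@ct j) (xt i) (xt j).
have [u [uc ua _]] := crossing_visits cP ti (@ct i) (xt i) (turnl (lab1 i y)).
have [v [vc vb _]] := crossing_visits cP ti (@ct i) (xt i) (turnr (lab1 i y)).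
apply: (@second_gap _ c r _ _ [:: y; z; u; v]) => //.
- by apply: lab2_convex; rewrite // eq_sym.
- by move=> w; rewrite !inE => /or4P[] /eqP ->.
rewrite /= !inE !negb_or /lab2 !xpair_eqE -yz ua vb !eqxx !andbT.
by rewrite (introN eqP nyz); case: (lab1 i y); rewrite ?andbF.
Qed.

Lemma gap_choice i : exists x, gap c r (lab i) x.
Proof. by have [x gx] := two_regions_gap i; exists x; apply: (gap_map (f := fst)). Qed.

(** A left-turning triangle takes any gap of its own; a right-turning triangle then
    takes a gap of its star other than the one taken by its partner. *)
Lemma gap_assignment : exists f : I -> 'I_n,
  (forall i, gap c r (lab i) (f i)) /\
  (forall i j, s i -> ~~ s j -> meets (t j) (t i) -> f i != f j).
Proof.
have [f0 f0P] := fin_all_exists gap_choice.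
have /fin_all_exists[f1 f1P] : forall j, exists x, gap c r (lab j) x /\
    (~~ s j -> s (partner j) -> x != f0 (partner j)).
  move=> j; case sj: (s j); first by exists (f0 j).
  have [sp|sp] := boolP (s (partner j)); last by exists (f0 j).
  have [[e _]|[jp m]] := partnerP j; first by move: sp; rewrite -e sj.
  by have [x [gx nx]] := four_regions_gap (f0 (partner j)) sp sj m; exists x.
exists (fun i => if s i then f0 i else f1 i); split=> [i|i j si sj m].
  by case: ifP => _; [exact: f0P|case: (f1P i)].
rewrite si (negbTE sj); have ji : j != i by apply/eqP => e; move: sj; rewrite e si.
have [[e no]|[jp m']] := partnerP j; first by move: (no i ji); rewrite m.
have e : partner j = i.
  by apply: (@partner_unique _ _ j); [rewrite eq_sym|rewrite eq_sym|exact: meetsC..].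
by rewrite eq_sym -e; apply: (f1P j).2 => //; rewrite e.
Qed.

(** Two stars (or single triangles) none of whose triangles meet lie each in a single
    region of the other, by [apart_linked]. *)
Lemma lab_compatible i j : i != j -> ~~ meets (t i) (t j) -> exists a b,
  forall z, z \in c -> lab i z = a \/ lab j z = b.
Proof.
move=> ij nm.
have lnk k : k = partner k \/ k != partner k /\ meets (t k) (t (partner k)).
  by have [[? _]|?] := partnerP k; [left|right].
have cross k l : k != l -> ~~ meets (t k) (t l) -> k != partner l /\ ~~ meets (t k) (t (partner l)).
  move=> kl nkl; case: (lnk l) => [<- //|[lp m]].
  have kp : k != partner l.
    by apply: contraNneq nkl => e; rewrite e; apply: meetsC.
  split=> //; apply/negP => mk.
  by move: kl; rewrite (partner_unique kp lp mk m) eqxx.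
have nmC k l : k != l -> ~~ meets (t k) (t l) -> l != k /\ ~~ meets (t l) (t k).
  by move=> kl nkl; rewrite eq_sym; split=> //; apply: contra nkl; apply: meetsC; rewrite eq_sym.
have [ij' nm'] := cross _ _ ij nm.
have [ji nmji] := nmC _ _ ij nm.
have [ji' /(nmC _ _ ji')[i'j nmi'j]] := cross _ _ ji nmji.
have [i'j' nmi'j'] := cross _ _ i'j nmi'j.
have ap k l : k != l -> ~~ meets (t k) (t l) -> exists a b, apart (t k) (t l) a b.
  by move=> kl; exact: not_meets_apart (tt k) (tt l) (dj kl).
have [a1 [b1 A1]] := ap _ _ ij nm.
have [a2 [b2 A2]] := ap _ _ ij' nm'.
have [a3 [b3 A3]] := ap _ _ i'j nmi'j.
have [a4 [b4 A4]] := ap _ _ i'j' nmi'j'.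
have link k l u a b a' b' : k = l \/ k != l /\ meets (t k) (t l) -> l != u ->
    apart (t k) (t u) a b -> apart (t l) (t u) a' b' -> b = b'.
  move=> [<-|[kl m]] lu h1 h2.
    by case: h1 h2 => _ h _ [_ h' _]; rewrite -(h NE) h'.
  exact: apart_linked (dj kl) (dj lu) m h1 h2.
have e12 : a1 = a2.
  by apply: (link _ _ _ _ _ _ _ (lnk j)) (apart_sym A1) (apart_sym A2); rewrite eq_sym.
have e34 : a3 = a4.
  by apply: (link _ _ _ _ _ _ _ (lnk j)) (apart_sym A3) (apart_sym A4); rewrite eq_sym.
have e13 : b1 = b3 := link _ _ _ _ _ _ _ (lnk i) i'j A1 A3.
have e24 : b2 = b4 := link _ _ _ _ _ _ _ (lnk i) i'j' A2 A4.
subst a2 a4 b3 b4; exists (a1, a3), (b1, b2) => z zc.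
have o k : off (t k) z by exact: (off_orbit (@ct k) zc).
case: A1 A2 A3 A4 => _ _ /(_ z (o _) (o _)) h1 [_ _ /(_ z (o _) (o _)) h2].
move=> [_ _ /(_ z (o _) (o _)) h3] [_ _ /(_ z (o _) (o _)) h4].
rewrite /lab2; case: h1 => e1; case: h2 => e2; case: h3 => e3; case: h4 => e4;
  solve [left; congruence | right; congruence].
Qed.

Lemma gap_assignment_inj : exists f : I -> 'I_n,
  injective f /\ forall i, gap c r (lab i) (f i).
Proof.
have [f [fP fne]] := gap_assignment; exists f; split=> // i j e.
apply/eqP/negPn/negP => ij; have [m|nm] := boolP (meets (t i) (t j)).
  have [sij _] := meets_opposite (tt i) (tt j) (dj ij) m.
  case si: (s i) sij; case sj: (s j) => // _.
    by move: (fne i j); rewrite si sj e eqxx => /(_ isT isT (meetsC ij m)).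
  by move: (fne j i); rewrite si sj e eqxx => /(_ isT isT m).
have [a [b cmp]] := lab_compatible ij nm.
by apply: (gap_compatible rc cmp (fP i)); rewrite e.
Qed.

(** The gaps are indexed by the elements of c other than the least and the
    greatest. *)
Lemma card_crossed_triangles : (forall x, sigma x != x) -> #|I| + 2 <= #|c|.
Proof.
move=> moved; have [f [finj fP]] := gap_assignment_inj.
have sr : sigma r \in c := orbit_step cP rc.
case: (arg_maxnP (fun z : 'I_n => z : nat) rc) => M McP Mmax; have Mc : M \in c := McP.
have Mr : r != M.
  apply: contra (moved r) => /eqP e; apply/eqP/val_inj/eqP; rewrite eqn_leq rmin // andbT.
  by rewrite {2}e; apply: Mmax.
have : [set f i | i in I] \subset c :\ r :\ M.
  apply/fintype.subsetP => _ /imsetP[i _ ->]; have [fc [y [yc fy _ [_ nr _]]]] := fP i.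
  rewrite !inE fc andbT; apply/andP; split; last by apply: contra nr => /eqP ->.
  by apply: contraTneq fy => ->; rewrite -leqNgt; apply: Mmax.
move/subset_leq_card; rewrite card_imset //.
have := cardsD1 r c; have := cardsD1 M (c :\ r); rewrite !inE rc Mc eq_sym Mr /=.
by move=> e1 ->; rewrite e1 addnC.
Qed.
End Counting.

(** The three beams have pairwise distinct directions, as consecutive directions
    differ. *)
Lemma triangle_of_orbit c : (forall x, sigma x != x) -> c \in porbits sigma -> #|c| = 3 ->
  exists s t, [/\ triangle s t, forall d, t d \in c & forall x, x \in c -> exists d, x = t d].
Proof.
move=> moved cP c3; have [x xc] : exists x, x \in c by apply/card_gt0P; rewrite c3.
have sxc := orbit_step cP xc; have ssxc := orbit_step cP sxc.
have s3 : sigma (sigma (sigma x)) = x.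
  by have := iter_porbit sigma x; rewrite -(orbit_porbit cP xc) c3.
have ss y : y \in c -> sigma (sigma y) != y.
  move=> yc; apply/eqP => e; suff: #|c| <= 2 by rewrite c3.
  have: c \subset [set y; sigma y].
    apply/fintype.subsetP => z.
    apply: (orbit_ind (P := fun z => z \in [set y; sigma y]) cP yc) => [|w _].
      by rewrite !inE eqxx.
    by rewrite !inE => /orP[]/eqP->; rewrite ?e eqxx ?orbT.
  by move/subset_leq_card/leq_trans; apply; rewrite cards2; case: (_ == _).
have all3 y : y \in c -> [\/ y = x, y = sigma x | y = sigma (sigma x)].
  pose Q y := [\/ y = x, y = sigma x | y = sigma (sigma x)].
  move=> yc; apply: (orbit_ind (P := Q) cP xc) yc.
    by constructor 1.
  by move=> w _ [] ->; rewrite ?s3; [constructor 2|constructor 3|constructor 1].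
have turns y : y \in c -> ty (sigma y) = turnl (ty y) \/ ty (sigma y) = turnr (ty y).
  by move=> yc; have [[]|[]] := turn (ss y yc); auto.
have [s [e1 e2 e3]] : exists s : bool, let m := if s then turnl else turnr in
  [/\ ty (sigma x) = m (ty x), ty (sigma (sigma x)) = m (ty (sigma x)) &
      ty x = m (ty (sigma (sigma x)))].
  move: (turns _ xc) (turns _ sxc) (turns _ ssxc); rewrite s3.
  case: (ty x) => -[] -> [] -> [] //= _; first [by exists true | by exists false].
pose m := if s then turnl else turnr.
exists s, (fun d => if d == ty x then x else if d == m (ty x) then sigma x else sigma (sigma x)).
split=> [d|d|y /all3 yE].
- rewrite /m; move: e1 e2 e3; case: (s); case et: (ty x); case: d => /= -> -> /= _;
    rewrite ?et ?s3 //.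
- by case: ifP => // _; case: ifP.
exists (ty y); case: yE => ->; rewrite ?eqxx //.
  by rewrite e1 -/m eqxx /m; case: (s); case: (ty x).
by rewrite e2 e1 /m; case: (s); case: (ty x).
Qed.
End Cycles.

(** * The lattice of half panes and the winding number *)
Import Order.TTheory GRing.Theory Num.Theory.
Local Open Scope ring_scope.

(** Coordinates in the basis (1/2, 0), (1/4, sqrt 3 / 4): a vertex a of the grid is the
    point a + a, and the midpoint of the pane from a to b is a + b. *)
Notation vec := (int * int)%type.
Definition unit_vectors : seq vec := [:: (1, 0); (0, 1); (-1, 1); (-1, 0); (0, -1); (1, -1)].
(** Rotations by 60 degrees, counterclockwise and clockwise. *)
Definition rot (E : vec) : vec := (- E.2, E.1 + E.2).
Definition unrot (E : vec) : vec := (E.1 + E.2, - E.1).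
(** Three times the centroid of the triangle w, w + E, w + rot E, which is the cell on
    the left of the edge from w to w + E; on its right is [cell w (unrot E)]. *)
Definition cell (w E : vec) : vec := (3 * w.1 + E.1 - E.2, 3 * w.2 + E.1 + 2 * E.2).

(** Contribution of the step from p to p + D to the number of turns, counted
    counterclockwise, around the cell q: the signed crossing of the step with the
    horizontal ray from q to the west. *)
Definition ray (p D q : vec) : int :=
  let k : int := if D.1 == 0 then 0 else 1 in
  let beyond : bool := 3 * (p.1 + k * p.2) < q.1 + k * q.2 in
  if D.2 == 1 then - ((beyond && (3 * p.2 < q.2 < 3 * p.2 + 3)) : nat)%:Z
  else if D.2 == -1 then ((beyond && (3 * p.2 - 3 < q.2 < 3 * p.2)) : nat)%:Z
  else 0.

(** Number of times that the step h runs through the edge g, negative if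
    backwards. *)
Definition traversals (h g : vec * vec) : int :=
  ((h == g) : nat)%:Z - (((h.1 + h.2, - h.2) == g) : nat)%:Z.

(** For a horizontal edge, the rays of the two adjacent cells lie in different
    rows; this is the boundary term of the comparison, which telescopes along a path
    and cancels on a closed path. *)
Definition ray_potential (w E p : vec) : int :=
  if E == (1, 0) then ((p.2 == w.2) && (p.1 <= w.1) : nat)%:Z
  else if E == (-1, 0) then - ((p.2 == w.2) && (p.1 <= w.1 - 1) : nat)%:Z
  else 0.

Lemma ray_jump p D w E : D \in unit_vectors -> E \in unit_vectors ->
  ray p D (cell w E) - ray p D (cell w (unrot E)) =
  traversals (p, D) (w, E) + ray_potential w E (p + D) - ray_potential w E p.
Proof.
case: p w => [p1 p2] [w1 w2].
rewrite !inE => /or4P[|||/or3P[]] /eqP-> /or4P[|||/or3P[]] /eqP->;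
rewrite /ray /ray_potential /traversals /cell /unrot /= !xpair_eqE /=; lia.
Qed.

Definition advance (p D : vec) (s : nat) : vec := (p.1 + s%:Z * D.1, p.2 + s%:Z * D.2).

Lemma advance0 p D : advance p D 0 = p.
Proof. by case: p => a b; rewrite /advance /= !mul0r !addr0. Qed.

Lemma advanceS p D s : advance p D s.+1 = advance p D s + D.
Proof. by case: p D => [a b] [x y]; rewrite /advance; congr pair => /=; lia. Qed.

Definition dir_vec d : vec := match d with NE => (0, 1) | West => (-1, 0) | SE => (1, -1) end.

Lemma dir_vec_unit d : dir_vec d \in unit_vectors. Proof. by case: d. Qed.
Lemma rotK E : rot (unrot E) = E.
Proof. by case: E => x y; rewrite /rot /unrot; congr pair => /=; lia. Qed.
Lemma unrotK E : unrot (rot E) = E.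
Proof. by case: E => x y; rewrite /rot /unrot; congr pair => /=; lia. Qed.
Lemma rot_unit E : E \in unit_vectors -> rot E \in unit_vectors.
Proof. by rewrite !inE => /or4P[|||/or3P[]] /eqP->. Qed.
Lemma unrot_unit E : E \in unit_vectors -> unrot E \in unit_vectors.
Proof. by rewrite !inE => /or4P[|||/or3P[]] /eqP->. Qed.
Lemma opp_unit E : E \in unit_vectors -> - E \in unit_vectors.
Proof. by rewrite !inE => /or4P[|||/or3P[]] /eqP->. Qed.
Lemma cell_next w E : cell w E = cell (w + E) (rot (rot E)).
Proof. by case: w E => [a b] [x y]; rewrite /cell /rot; congr pair => /=; lia. Qed.

Section CyclicTelescope.
Variables (n : nat) (i j : 'I_n) (g : 'I_n -> int).
Hypothesis ij : i != j.

(** The indicator of the arc changes only at its two ends. *)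
Lemma arc_ordS (k : 'I_n) :
  ((arc i j k : nat)%:Z - (arc i j (ordS k) : nat)%:Z =
  ((ordS k == j) : nat)%:Z - ((k == i) : nat)%:Z :> int).
Proof.
have [ki kj] := (ltn_ord i, ltn_ord j); have kn := ltn_ord k.
move: ij; rewrite -!val_eqE /= /arc.
have [e|l] := ltnP k.+1 n; first by rewrite modn_small // => ?; lia.
have e : k.+1 = n by apply/eqP; rewrite eqn_leq l kn.
by rewrite e modnn => ?; lia.
Qed.

Lemma sum_arc_telescope :
  \sum_(k : 'I_n | arc i j k) (g (ordS k) - g k) = g j - g (ordS i).
Proof.
have e1 : \sum_(k : 'I_n | arc i j k) g k = \sum_(k < n) (arc i j (ordS k) : nat)%:Z * g (ordS k).
  rewrite big_mkcond (reindex_inj (@ordS_inj n)) /=; apply: eq_bigr => k _.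
  by case: arc; rewrite ?mul1r ?mul0r.
have e2 : \sum_(k : 'I_n | arc i j k) g (ordS k) = \sum_(k < n) (arc i j k : nat)%:Z * g (ordS k).
  by rewrite big_mkcond /=; apply: eq_bigr => k _; case: arc; rewrite ?mul1r ?mul0r.
have e3 : \sum_(k < n) ((ordS k == j) : nat)%:Z * g (ordS k) = g j.
  transitivity (\sum_(k < n) ((k == j) : nat)%:Z * g k).
    by rewrite [RHS](reindex_inj (@ordS_inj n)).
  rewrite (bigD1 j) //= eqxx mul1r big1 ?addr0 // => k /negbTE ->.
  by rewrite mul0r.
have e4 : \sum_(k < n) ((k == i) : nat)%:Z * g (ordS k) = g (ordS i).
  rewrite (bigD1 i) //= eqxx mul1r big1 ?addr0 // => k /negbTE ->.
  by rewrite mul0r.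
have : \sum_(k < n) ((arc i j k : nat)%:Z * g (ordS k) - (arc i j (ordS k) : nat)%:Z * g (ordS k)) =
   \sum_(k < n) (((ordS k == j) : nat)%:Z * g (ordS k) - ((k == i) : nat)%:Z * g (ordS k)).
  by apply: eq_bigr => k _; rewrite -!mulrBl arc_ordS.
by rewrite !sumrB -e1 -e2 e3 e4.
Qed.
End CyclicTelescope.

Lemma ordS2_neq n (k : 'I_n) : (2 < n)%N -> ordS (ordS k) != k.
Proof.
move=> n2; have kn := ltn_ord k; rewrite -val_eqE /=.
have [l|l] := ltnP k.+1 n.
  rewrite (modn_small l); have [l'|l'] := ltnP k.+2 n; first by rewrite modn_small //; lia.
  have -> : k.+2 = n by apply/eqP; rewrite eqn_leq l' andbT.
  by rewrite modnn; lia.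
have -> : k.+1 = n by apply/eqP; rewrite eqn_leq l kn.
by rewrite modnn modn_small; lia.
Qed.

Lemma ordS_const (T : Type) m (f : 'I_m -> T) :
  (forall k, f (ordS k) = f k) -> forall k l, f k = f l.
Proof.
move=> fS; suff H (k : 'I_m) (i : nat) (im : (i < m)%N) : (i <= k)%N -> f k = f (Ordinal im).
  move=> k l; have m0 : (0 < m)%N by apply: leq_ltn_trans (ltn_ord k).
  by rewrite (H k 0 m0) // (H l 0 m0).
move=> ik; have [d] : exists d, k = (i + d)%N :> nat by exists (k - i)%N; rewrite subnKC.
elim: d k ik => [|d IH] k ik e.
  by congr f; apply/val_inj; rewrite /= e addn0.
have dm : (i + d < m)%N by rewrite (leq_trans _ (ltn_ord k)) // e addnS ltnS leqnSn.
rewrite -(IH (Ordinal dm)) ?leq_addr // -(fS (Ordinal dm)).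
by congr f; apply/val_inj; rewrite /= modn_small -addnS -e.
Qed.

Lemma grid_constant (T : Type) (g : vec -> T) :
  (forall w, g (w + (1, 0)) = g w) -> (forall w, g (w + (0, 1)) = g w) ->
  forall w w', g w = g w'.
Proof.
move=> g1 g2; have mono e : (forall w, g (w + e) = g w) -> forall (m : nat) w, g (w + e *+ m) = g w.
  by move=> ge; elim=> [|m IH] w; rewrite ?mulr0n ?addr0 // mulrSr addrA ge.
have mul1 (m : nat) : ((1, 0) : vec) *+ m = (m%:Z, 0).
  by elim: m => // m IH; rewrite mulrSr IH; congr pair => /=; lia.
have mul2 (m : nat) : ((0, 1) : vec) *+ m = (0, m%:Z).
  by elim: m => // m IH; rewrite mulrSr IH; congr pair => /=; lia.
have h1 a a' b : g (a, b) = g (a', b).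
  wlog aa' : a a' / (a <= a')%R => [H|].
    by have [/H|/ltW/H] := leP a a'.
  rewrite -(mono _ g1 `|a' - a|%N (a, b)) mul1; congr g; congr pair => /=; lia.
have h2 a b b' : g (a, b) = g (a, b').
  wlog bb' : b b' / (b <= b')%R => [H|].
    by have [/H|/ltW/H] := leP b b'.
  rewrite -(mono _ g2 `|b' - b|%N (a, b)) mul2; congr g; congr pair => /=; lia.
by case=> [a b] [a' b']; rewrite (h1 a a') (h2 a' b b').
Qed.

(** Pairs of directions are handled through the angle between them. *)
Lemma unit_rot_iter E E' : E \in unit_vectors -> E' \in unit_vectors ->
  exists2 a, (a < 6)%N & E' = iter a rot E.
Proof.
have /allP H : all (fun E => all (fun E' => has (fun a => E' == iter a rot E) (iota 0 6))
    unit_vectors) unit_vectors by vm_compute.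
by move=> /H /allP H' /H' /hasP[a]; rewrite mem_iota => al /eqP e; exists a.
Qed.

Lemma iter_rot_inj E a b : E \in unit_vectors -> (a < 6)%N -> (b < 6)%N ->
  iter a rot E = iter b rot E -> a = b.
Proof.
have /allP H : all (fun E => all (fun a => all (fun b =>
    (iter a rot E == iter b rot E) ==> (a == b)) (iota 0 6)) (iota 0 6))
    unit_vectors by vm_compute.
move=> /H /allP H' al bl e; have /allP/(_ b) := H' a ltac:(by rewrite mem_iota).
by rewrite mem_iota => /(_ bl); rewrite e eqxx => /eqP.
Qed.

Lemma iter_rot_unit a E : E \in unit_vectors -> iter a rot E \in unit_vectors.
Proof. by move=> uE; elim: a => //= a; apply: rot_unit. Qed.

Lemma iter6_rot E : iter 6 rot E = E.
Proof. by case: E => x y; rewrite /= /rot; congr pair => /=; lia. Qed.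

Lemma cell_flip w E : cell w (unrot E) = cell (w + E) (- E).
Proof. by case: w E => [a b] [x y]; rewrite /cell /unrot; congr pair => /=; lia. Qed.

Lemma unrot_opp E : unrot (- E) = rot (rot E).
Proof. by case: E => x y; rewrite /rot /unrot; congr pair => /=; lia. Qed.

(** Let a path come to w by the step A and leave it by the step B, and let f change
    around w only across these two edges, and vanish on the right of both.  Then f
    takes the same value on the left of both: turn around w from B to -A. *)
Lemma around_vertex (f : vec -> int) w A B :
  A \in unit_vectors -> B \in unit_vectors ->
  (forall E, E \in unit_vectors -> E <> B -> E <> - A ->
     f (cell w E) = f (cell w (unrot E))) ->
  f (cell w (- A)) = 0 -> f (cell w (unrot B)) = 0 ->
  f (cell w (rot (rot A))) = f (cell w B).
Proof.
move=> uA uB H zA zB; have [a a6 eA] := unit_rot_iter uB (opp_unit uA).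
case: a a6 eA => [|a] a6 eA.
  by rewrite -unrot_opp eA zB -[in RHS](_ : - A = B) ?zA.
have -> : rot (rot A) = iter a rot B by rewrite -unrot_opp eA /= unrotK.
have: (a < a.+1)%N by [].
elim: {-2}a => // k IH ka; rewrite -{}IH; last exact: ltn_trans ka.
rewrite H ?iter_rot_unit //= ?unrotK // -?[rot (iter k rot B)]/(iter k.+1 rot B).
  by move/(@iter_rot_inj B k.+1 0 uB); lia.
by rewrite eA => /(@iter_rot_inj B k.+1 a.+1 uB); lia.
Qed.

Lemma cells_constant (f : vec -> int) :
  (forall w E, E \in unit_vectors -> f (cell w E) = f (cell w (unrot E))) ->
  forall w E w' E', E \in unit_vectors -> E' \in unit_vectors -> f (cell w E) = f (cell w' E').
Proof.
move=> H; pose g w := f (cell w (1, 0)).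
have fg w E : E \in unit_vectors -> f (cell w E) = g w.
  move=> uE; have [a _ ->] := @unit_rot_iter (1, 0) E isT uE.
  by elim: a => //= a <-; rewrite H ?unrotK // -[rot _]/(iter a.+1 rot (1, 0)) iter_rot_unit.
have gE w E : E \in unit_vectors -> g (w + E) = g w.
  by move=> uE; rewrite -(fg w E) // cell_next fg // !rot_unit.
by move=> w E w' E' uE uE'; rewrite !fg //; apply: grid_constant => z; rewrite gE.
Qed.

Lemma traversals_eq0 h g : h <> g -> (h.1 + h.2, - h.2) <> g -> traversals h g = 0.
Proof. by move=> /eqP/negbTE n1 /eqP/negbTE n2; rewrite /traversals n1 n2. Qed.

Lemma ray_below p D q : q.2 < 3 * p.2 - 3 -> ray p D q = 0.
Proof.
move=> l; rewrite /ray.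
have -> : (3 * p.2 < q.2 < 3 * p.2 + 3) = false by lia.
have -> : (3 * p.2 - 3 < q.2 < 3 * p.2) = false by lia.
by rewrite andbF; case: ifP => //; case: ifP.
Qed.

Lemma family_bound m (f : 'I_m -> int) : exists b, forall k, b <= f k.
Proof.
exists (- \sum_k `|f k|) => k.
have : `|f k| <= \sum_k `|f k| by rewrite (bigD1 k) //= lerDl sumr_ge0.
lia.
Qed.

Lemma unrot3 E : unrot (unrot (unrot E)) = - E.
Proof. by case: E => x y; rewrite /unrot; congr pair => /=; lia. Qed.

Lemma rotN E : rot (- E) = - rot E.
Proof. by case: E => x y; rewrite /rot; congr pair => /=; lia. Qed.

Lemma rot_dir_vec d : rot (dir_vec d) = - dir_vec (turnr d).
Proof. by case: d. Qed.

Lemma rot2_dir_vec d : rot (rot (dir_vec d)) = dir_vec (turnl d).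
Proof. by case: d. Qed.

Lemma dir_vec_inj d d' : dir_vec d = dir_vec d' -> d = d'.
Proof. by case: d; case: d'. Qed.

(** * The boundary and a discrete Jordan theorem *)
Section Panes.
Variables (n : nat) (v : 'I_n -> vec).
Hypotheses (n3 : (2 < n)%N) (v_inj : injective v).
Hypothesis v_adj : forall i, v (ordS i) - v i \in unit_vectors.

Definition pvec k : vec := v (ordS k) - v k.
Definition pbeg k : vec := v k + v k.
Definition pmid k : vec := v k + v (ordS k).

Lemma pmidE k : pmid k = pbeg k + pvec k.
Proof. by rewrite /pmid /pbeg /pvec -addrA [v k + (_ - _)]addrC subrK. Qed.
Lemma pendE k : pbeg (ordS k) = pmid k + pvec k.
Proof. by rewrite /pmid /pbeg /pvec [v k + _]addrC -addrA [v k + _]addrC subrK. Qed.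

(** The two halves of the pane k, each with both orientations. *)
Definition half_edges k : seq (vec * vec) :=
  [:: (pbeg k, pvec k); (pmid k, pvec k); (pmid k, - pvec k); (pbeg (ordS k), - pvec k)].

Definition on_boundary w E : bool := [exists k, (w, E) \in half_edges k].

Lemma on_boundaryP w E : reflect (exists k, [\/ w = pbeg k /\ E = pvec k,
  w = pmid k /\ E = pvec k, w = pmid k /\ E = - pvec k |
  w = pbeg (ordS k) /\ E = - pvec k]) (on_boundary w E).
Proof.
apply: (iffP existsP) => -[k p]; exists k.
  by move: p; rewrite !inE => /or4P[] /eqP/pair_equal_spec ?;
    [constructor 1|constructor 2|constructor 3|constructor 4].
by rewrite !inE; case: p => -[-> ->]; rewrite eqxx ?orbT.
Qed.

(** Modulo 2, a midpoint determines the direction of its pane up to sign. *)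
Lemma parity_units D D' (a b : vec) : D \in unit_vectors -> D' \in unit_vectors ->
  a + a + D = b + b + D' -> (a = b /\ D = D') \/ (b = a + D /\ D' = - D).
Proof.
case: a b => [a1 a2] [b1 b2].
rewrite !inE => /or4P[|||/or3P[]] /eqP-> /or4P[|||/or3P[]] /eqP-> [e1 e2];
solve [left; split=> //; congr pair; lia | right; split=> //; congr pair => /=; lia | lia].
Qed.

Lemma parity_unit0 D (a b : vec) : D \in unit_vectors -> a + a + D <> b + b.
Proof.
by case: a b => [a1 a2] [b1 b2]; rewrite !inE => /or4P[|||/or3P[]] /eqP-> [e1 e2]; lia.
Qed.

Lemma pmid_inj : injective pmid.
Proof.
move=> k l; rewrite !pmidE => e.
have [[/v_inj //]|[e1 e2]] := parity_units (v_adj k) (v_adj l) e.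
have /v_inj ekl : v l = v (ordS k) by rewrite e1 /pvec addrC subrK.
have /v_inj elk : v k = v (ordS l) by rewrite -[RHS](subrK (v l)) e2 e1 addrC addrK.
by move: (ordS2_neq k n3); rewrite -ekl -elk eqxx.
Qed.

Lemma pmid_pbeg k l : pmid k <> pbeg l.
Proof. by rewrite pmidE; apply/parity_unit0/v_adj. Qed.

Lemma on_boundary_mid k E : on_boundary (pmid k) E -> E = pvec k \/ E = - pvec k.
Proof.
case/on_boundaryP=> l [] [e ->].
- by have := pmid_pbeg e.
- by rewrite (pmid_inj e); left.
- by rewrite (pmid_inj e); right.
- by have := pmid_pbeg e.
Qed.

Lemma pbeg_inj : injective pbeg.
Proof.
move=> k l; rewrite /pbeg => e; apply: v_inj; move: e.
by case: (v k) (v l) => [a b] [x y] [] *; congr pair; lia.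
Qed.

Lemma on_boundary_beg k E : on_boundary (pbeg (ordS k)) E -> E = pvec (ordS k) \/ E = - pvec k.
Proof.
case/on_boundaryP=> l [] [e ->].
- by rewrite (pbeg_inj e); left.
- by have := pmid_pbeg (esym e).
- by have := pmid_pbeg (esym e).
- by rewrite (ordS_inj (pbeg_inj e)); right.
Qed.

Lemma on_boundary_at w E : on_boundary w E -> exists k, w = pmid k \/ w = pbeg k.
Proof.
case/on_boundaryP=> l [] [-> _].
- by exists l; right.
- by exists l; left.
- by exists l; left.
- by exists (ordS l); right.
Qed.

Lemma on_boundary_rev w E : on_boundary w E = on_boundary (w + E) (- E).
Proof.
have half w' E' : on_boundary w' E' -> on_boundary (w' + E') (- E').
  case/on_boundaryP=> l h; apply/on_boundaryP; exists l; case: h => -[-> ->].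
  - by constructor 3; rewrite -pmidE.
  - by constructor 4; rewrite -pendE.
  - by constructor 1; rewrite {1}pmidE addrK opprK.
  - by constructor 2; rewrite pendE addrK opprK.
by apply/idP/idP => /half //; rewrite addrK opprK.
Qed.

Section Jordan.
Variable inside : vec -> bool.

Definition sides_agree := forall w E, E \in unit_vectors -> ~~ on_boundary w E ->
  inside (cell w E) = inside (cell w (unrot E)).
Definition inside_on_right := forall k,
  [/\ inside (cell (pbeg k) (unrot (pvec k))), inside (cell (pmid k) (unrot (pvec k))),
   ~~ inside (cell (pbeg k) (pvec k)) & ~~ inside (cell (pmid k) (pvec k))].
Definition inside_bounded := exists B : int, forall q, q.2 < B -> ~~ inside q.

Hypotheses (agree : sides_agree) (right_in : inside_on_right) (bounded : inside_bounded).

(** By [around_vertex], the value of f on the outer side of the boundary is a constant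
    kap.  Then f + kap * inside changes nowhere, so it is constant, and it vanishes
    far away; being kap inside, it gives kap = 0. *)
Lemma vanishes_outside (f : vec -> int) :
  (forall w E, E \in unit_vectors -> ~~ on_boundary w E -> f (cell w E) = f (cell w (unrot E))) ->
  (forall q, inside q -> f q = 0) -> (exists B : int, forall q, q.2 < B -> f q = 0) ->
  forall w E, E \in unit_vectors -> f (cell w E) = 0.
Proof.
move=> fj fin [B fB]; pose k0 := Ordinal (ltn_trans (isT : 0 < 2)%N n3).
pose kap := f (cell (pbeg k0) (pvec k0)).
have midE k : f (cell (pbeg k) (pvec k)) = f (cell (pmid k) (pvec k)).
  have [r1 r2 _ _] := right_in k.
  rewrite [X in X = _](congr1 f (cell_next _ _)) -pmidE.
  apply: around_vertex; rewrite ?v_adj // -?cell_flip.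
  - move=> E uE n1 n2; apply: fj => //.
    by apply/negP => /on_boundary_mid[].
  - by rewrite pmidE -cell_flip fin.
  - exact: fin.
have begE k : f (cell (pmid k) (pvec k)) = f (cell (pbeg (ordS k)) (pvec (ordS k))).
  have [r1 r2 _ _] := right_in k; have [r1' _ _ _] := right_in (ordS k).
  rewrite [X in X = _](congr1 f (cell_next _ _)) -pendE.
  apply: around_vertex; rewrite ?v_adj // -?cell_flip.
  - move=> E uE n1 n2; apply: fj => //.
    by apply/negP => /on_boundary_beg[].
  - by rewrite pendE -cell_flip fin.
  - exact: fin.
have begK k : f (cell (pbeg k) (pvec k)) = kap.
  apply: (ordS_const (f := fun k => f (cell (pbeg k) (pvec k)))) => l.
  by rewrite -begE -midE.
pose f' q := f q + kap * (inside q : nat)%:Z.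
have f'j w E : E \in unit_vectors -> f' (cell w E) = f' (cell w (unrot E)).
  move=> uE; rewrite /f'; have [/on_boundaryP[k]|nb] := boolP (on_boundary w E).
  2: by rewrite fj // agree.
  have [r1 r2 l1 l2] := right_in k; case=> -[-> ->].
  - by rewrite begK (fin _ r1) r1 (negbTE l1); lia.
  - by rewrite -midE begK (fin _ r2) r2 (negbTE l2); lia.
  - rewrite unrot_opp pmidE -cell_flip -cell_next.
    by rewrite begK (fin _ r1) r1 (negbTE l1); lia.
  - rewrite unrot_opp pendE -cell_flip -cell_next.
    by rewrite -midE begK (fin _ r2) r2 (negbTE l2); lia.
have [B' inB'] := bounded.
have f'0 w E : E \in unit_vectors -> f' (cell w E) = 0.
  move=> uE; pose b := - `|B| - `|B'| - 3.
  rewrite (cells_constant f'j w (0, b) uE (E' := (1, 0))) // /f' fB ?(negbTE (inB' _ _)) /= ?mulr0 //.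
  - by rewrite /b; lia.
  - by rewrite /b; lia.
have kap0 : kap = 0.
  have [r1 _ _ _] := right_in k0.
  by have := f'0 (pbeg k0) _ (unrot_unit (v_adj k0)); rewrite /f' fin // r1; lia.
by move=> w E uE; have := f'0 w E uE; rewrite /f' kap0 mul0r addr0.
Qed.
End Jordan.

(** * The side of a beam, read on the winding number *)
Section Beams.
Variables (inside : vec -> bool).
Hypotheses (agree : sides_agree inside) (right_in : inside_on_right inside)
  (bounded : inside_bounded inside).
Variables (sigma : {perm 'I_n}) (ty : 'I_n -> dir) (len : 'I_n -> nat).

Local Notation dv i := (dir_vec (ty i)).
Definition track i s : vec := advance (pmid i) (dv i) s.

Definition beams_land := forall i, (0 < len i)%N /\ track i (len i) = pmid (sigma i).
Definition beams_inside := forall i s, (s < len i)%N ->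
  inside (cell (track i s) (dv i)) /\ inside (cell (track i s) (unrot (dv i))).
Definition beams_avoid_boundary := forall i s k, (0 < s < len i)%N ->
  track i s <> pmid k /\ track i s <> pbeg k.

Hypotheses (land : beams_land) (lit : beams_inside) (avoid : beams_avoid_boundary).

Lemma sigma_moves i : sigma i != i.
Proof.
apply/eqP => e; have [l0] := land i; rewrite e /track /advance; move: l0.
case: (pmid i) => a b; case: (ty i) => /= l0 [e1 e2]; lia.
Qed.

Definition beam_count i h : int := \sum_(s < len i) traversals (track i s, dv i) h.

Definition return_count i h : int :=
  traversals (pmid i, pvec i) h +
  \sum_(k < n | left sigma i k) (traversals (pbeg k, pvec k) h + traversals (pmid k, pvec k) h) +
  traversals (pbeg (sigma i), pvec (sigma i)) h.

(** Winding number around q of the closed path made of the beam i and the boundary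
    from sigma i back to i, counterclockwise. *)
Definition winding i q : int :=
  \sum_(s < len i) ray (track i s) (dv i) q -
  (ray (pmid i) (pvec i) q +
   \sum_(k < n | left sigma i k) (ray (pbeg k) (pvec k) q + ray (pmid k) (pvec k) q) +
   ray (pbeg (sigma i)) (pvec (sigma i)) q).

Lemma winding_jump i w E : E \in unit_vectors ->
  winding i (cell w E) - winding i (cell w (unrot E)) =
  beam_count i (w, E) - return_count i (w, E).
Proof.
move=> uE; have rj p D : D \in unit_vectors -> ray p D (cell w E) =
    ray p D (cell w (unrot E)) + (traversals (p, D) (w, E) + (ray_potential w E (p + D) - ray_potential w E p)).
  by move=> uD; have := ray_jump p w uD uE; lia.
have tel : \sum_(k < n | left sigma i k) (ray_potential w E (pbeg (ordS k)) - ray_potential w E (pbeg k)) =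
    ray_potential w E (pbeg (sigma i)) - ray_potential w E (pbeg (ordS i)).
  by apply: (sum_arc_telescope (fun k => ray_potential w E (pbeg k))); rewrite eq_sym sigma_moves.
have tel' : \sum_(s < len i) (ray_potential w E (track i s + dv i) - ray_potential w E (track i s)) =
    ray_potential w E (pmid (sigma i)) - ray_potential w E (pmid i).
  rewrite -(land i).2 -[pmid i in RHS](advance0 _ (dv i)) -/(track i 0).
  elim: (len i) => [|m IH]; first by rewrite big_ord0 subrr.
  by rewrite big_ord_recr /= IH /track advanceS; ring.
have e1 : \sum_(s < len i) ray (track i s) (dv i) (cell w E) =
    \sum_(s < len i) ray (track i s) (dv i) (cell w (unrot E)) +
    (beam_count i (w, E) + (ray_potential w E (pmid (sigma i)) - ray_potential w E (pmid i))).
  rewrite -tel' /beam_count -!big_split /=; apply: eq_bigr => s _.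
  by rewrite rj ?dir_vec_unit.
have e2 : \sum_(k < n | left sigma i k) (ray (pbeg k) (pvec k) (cell w E) + ray (pmid k) (pvec k) (cell w E)) =
    \sum_(k < n | left sigma i k) (ray (pbeg k) (pvec k) (cell w (unrot E)) + ray (pmid k) (pvec k) (cell w (unrot E))) +
    (\sum_(k < n | left sigma i k) (traversals (pbeg k, pvec k) (w, E) + traversals (pmid k, pvec k) (w, E)) +
    (ray_potential w E (pbeg (sigma i)) - ray_potential w E (pbeg (ordS i)))).
  rewrite -tel -[X in _ = _ + X]big_split -[RHS]big_split /=; apply: eq_bigr => k _.
  by rewrite rj ?v_adj // (rj (pmid k)) ?v_adj // -pmidE -pendE; ring.
rewrite /winding /return_count e1 e2 rj ?v_adj // (rj (pbeg (sigma i))) ?v_adj //.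
by rewrite -pmidE -pendE; ring.
Qed.

Lemma return_count_off i w E : ~~ on_boundary w E -> return_count i (w, E) = 0.
Proof.
move=> nb; have z k : traversals (pbeg k, pvec k) (w, E) = 0 /\ traversals (pmid k, pvec k) (w, E) = 0.
  split; apply: traversals_eq0 => /= -/pair_equal_spec[e1 e2]; case/negP: nb;
    apply/on_boundaryP; exists k; rewrite -e1 -e2.
  - by constructor 1.
  - by constructor 3; rewrite -pmidE.
  - by constructor 2.
  - by constructor 4; rewrite -pendE.
by rewrite /return_count (z i).2 (z _).1 big1 ?addr0 // => k _; rewrite (z k).1 (z k).2.
Qed.

Lemma beam_count_dark i w E : ~~ inside (cell w E) -> beam_count i (w, E) = 0.
Proof.
move=> out; apply: big1 => s _; have [in1 in2] := lit (ltn_ord s).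
apply: traversals_eq0 => /= /pair_equal_spec[e1 e2]; case/negP: out; rewrite -e1 -e2 //.
by rewrite -cell_flip.
Qed.

Lemma beam_count_off i w E : (forall s, (s <= len i)%N -> track i s <> w) -> beam_count i (w, E) = 0.
Proof.
move=> off; apply: big1 => s _; apply: traversals_eq0 => /= /pair_equal_spec[e1 e2].
  by apply: off e1; apply: ltnW.
by apply: (off s.+1) => //; rewrite -e1 /track advanceS.
Qed.

Lemma winding_below i : exists B : int, forall q, q.2 < B -> winding i q = 0.
Proof.
have [b1 h1] : exists b, forall k, b <= (pbeg k).2 := family_bound _.
have [b2 h2] : exists b, forall k, b <= (pmid k).2 := family_bound _.
have [b3 h3] : exists b, forall s : 'I_(len i), b <= (track i s).2 := family_bound _.
exists (3 * (- `|b1| - `|b2| - `|b3|) - 3) => q ql; rewrite /winding.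
have z1 k : ray (pbeg k) (pvec k) q = 0.
  apply: ray_below; apply: lt_le_trans ql _.
  by rewrite lerB // ler_wpM2l // (le_trans _ (h1 k)) //; clear; lia.
have z2 k : ray (pmid k) (pvec k) q = 0.
  apply: ray_below; apply: lt_le_trans ql _.
  by rewrite lerB // ler_wpM2l // (le_trans _ (h2 k)) //; clear; lia.
rewrite z1 z2 big1 ?big1 ?addr0 ?subr0 // => [k _|s _]; first by rewrite z1 z2.
apply: ray_below; apply: lt_le_trans ql _.
by rewrite lerB // ler_wpM2l // (le_trans _ (h3 s)) //; clear; lia.
Qed.

(** Apply [vanishes_outside] to the winding number restricted to the cells outside P:
    beams run inside P, so the restriction changes only across the boundary. *)
Lemma winding_outside i w E : E \in unit_vectors -> ~~ inside (cell w E) ->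
  winding i (cell w E) = 0.
Proof.
move=> uE out; pose f q := if inside q then 0 else winding i q.
suff: f (cell w E) = 0 by rewrite /f (negbTE out).
apply: (vanishes_outside agree right_in bounded) uE => {w E out} [w E uE nb|q qi|].
- rewrite /f -agree //; case: ifP => // /negbT out.
  have := winding_jump i w uE; rewrite beam_count_dark // return_count_off //; lia.
- by rewrite /f qi.
have [B hB] := winding_below i; exists B => q ql; rewrite /f hB //.
by case: ifP.
Qed.

Lemma pvec_neq0 k : pvec k <> - pvec k.
Proof. by move: (v_adj k); rewrite /pvec !inE => /or4P[|||/or3P[]] /eqP->. Qed.

Lemma traversals_beg_beg k l : traversals (pbeg k, pvec k) (pbeg l, pvec l) = ((k == l) : nat)%:Z.
Proof.
rewrite /traversals /= -pmidE xpair_eqE.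
have -> : (pmid k, - pvec k) == (pbeg l, pvec l) = false.
  by apply/eqP => /pair_equal_spec[/pmid_pbeg].
rewrite subr0; have [->|kl] := eqVneq k l; first by rewrite !eqxx.
by case: eqP => // /pbeg_inj e; rewrite e eqxx in kl.
Qed.

Lemma traversals_mid_mid k l : traversals (pmid k, pvec k) (pmid l, pvec l) = ((k == l) : nat)%:Z.
Proof.
rewrite /traversals /= -pendE xpair_eqE.
have -> : (pbeg (ordS k), - pvec k) == (pmid l, pvec l) = false.
  by apply/eqP => /pair_equal_spec[/esym/pmid_pbeg].
rewrite subr0; have [->|kl] := eqVneq k l; first by rewrite !eqxx.
by case: eqP => // /pmid_inj e; rewrite e eqxx in kl.
Qed.

Lemma traversals_beg_mid k l : traversals (pbeg k, pvec k) (pmid l, pvec l) = 0.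
Proof.
apply: traversals_eq0 => /= /pair_equal_spec[]; first by move/esym/pmid_pbeg.
by rewrite -pmidE => /pmid_inj -> /esym/pvec_neq0.
Qed.

Lemma traversals_mid_beg k l : traversals (pmid k, pvec k) (pbeg l, pvec l) = 0.
Proof.
apply: traversals_eq0 => /= /pair_equal_spec[]; first by move/pmid_pbeg.
rewrite -pendE => /pbeg_inj <- e; move: (ordS2_neq k n3).
have -> : ordS (ordS k) = k; last by rewrite eqxx.
by apply: v_inj; rewrite -[LHS](subrK (v (ordS k))) -/(pvec (ordS k)) -e opprB subrK.
Qed.

Lemma sum_delta (P : pred 'I_n) l : \sum_(k < n | P k) ((k == l) : nat)%:Z = (P l : nat)%:Z :> int.
Proof.
rewrite big_mkcond (bigD1 l) //= eqxx big1 ?addr0; first by case: (P l).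
by move=> k /negbTE ->; case: ifP.
Qed.

Lemma left_own i : left sigma i i = false /\ left sigma i (sigma i) = false.
Proof. by rewrite /left /arc; split; lia. Qed.

(** The cell on the left of a boundary edge is outside, so the value on its right is
    the number of times the closed path runs through this edge.  Of the
    panes i and sigma i only one half each belongs to the path, the clockwise second
    half of i and the clockwise first half of sigma i. *)
Lemma winding_right_beg i k : winding i (cell (pbeg k) (unrot (pvec k))) =
  (((k == sigma i) || left sigma i k) : nat)%:Z.
Proof.
have [_ _ l _] := right_in k; have := winding_jump i (pbeg k) (v_adj k).
rewrite -/(pvec k) winding_outside ?v_adj // beam_count_dark // /return_count.
rewrite traversals_mid_beg traversals_beg_beg (eq_bigr (fun k' : 'I_n => ((k' == k) : nat)%:Z)); last first.
  by move=> k' _; rewrite traversals_beg_beg traversals_mid_beg addr0.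
rewrite sum_delta [sigma i == k]eq_sym; case: (eqVneq k (sigma i)) => [->|_] /=.
  by rewrite (left_own i).2; lia.
by lia.
Qed.

Lemma winding_right_mid i k : winding i (cell (pmid k) (unrot (pvec k))) =
  (((k == i) || left sigma i k) : nat)%:Z.
Proof.
have [_ _ _ l] := right_in k; have := winding_jump i (pmid k) (v_adj k).
rewrite -/(pvec k) winding_outside ?v_adj // beam_count_dark // /return_count.
rewrite traversals_mid_mid traversals_beg_mid (eq_bigr (fun k' : 'I_n => ((k' == k) : nat)%:Z)); last first.
  by move=> k' _; rewrite traversals_beg_mid traversals_mid_mid add0r.
rewrite sum_delta [i == k]eq_sym; case: (eqVneq k i) => [->|_] /=.
  by rewrite (left_own i).1; lia.
by lia.
Qed.

Lemma winding_agree i w E : E \in unit_vectors -> ~~ on_boundary w E -> beam_count i (w, E) = 0 ->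
  winding i (cell w E) = winding i (cell w (unrot E)).
Proof.
by move=> uE nb b0; have := winding_jump i w uE; rewrite b0 return_count_off //; lia.
Qed.

Lemma track_mid i s u : (s <= len i)%N -> track i s = pmid u ->
  s = 0%N /\ u = i \/ s = len i /\ u = sigma i.
Proof.
move=> sl e; have [s0|s0] := posnP s.
  by left; split=> //; apply: pmid_inj; rewrite -e s0 /track advance0.
have [l|l|es] := ltngtP s (len i).
- by case: (@avoid i s u) => //; rewrite s0.
- by move: l; rewrite ltnNge sl.
by right; split=> //; apply: pmid_inj; rewrite -e es (land i).2.
Qed.

(** The two directions at the midpoint of a pane that point strictly inside. *)
Definition inward k E := E = unrot (pvec k) \/ E = unrot (unrot (pvec k)).

Lemma inward_not_boundary k E : inward k E -> ~~ on_boundary (pmid k) E.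
Proof.
move=> h; apply/negP => /on_boundary_mid; move: h; rewrite /inward /pvec.
by move: (v_adj k); rewrite !inE => /or4P[|||/or3P[]] /eqP-> [] -> [].
Qed.

(** The other four directions lie along the pane or border a cell outside P. *)
Lemma lit_inward k E : E \in unit_vectors -> inside (cell (pmid k) E) ->
  inside (cell (pmid k) (unrot E)) -> inward k E.
Proof.
move=> uE i1 i2; have [_ _ l1 l2] := right_in k.
rewrite cell_next -pmidE in l1.
have [a a6 e] := unit_rot_iter (v_adj k) uE; rewrite -/(pvec k) in e.
have six : rot (rot (rot (rot (rot (rot (pvec k)))))) = pvec k := iter6_rot (pvec k).
case: a a6 e => [|[|[|[|[|[|//]]]]]] _ /= e; rewrite e in i1 i2.
- by rewrite i1 in l2.
- by rewrite unrotK in i2; rewrite i2 in l2.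
- by rewrite i1 in l1.
- by rewrite unrotK in i2; rewrite i2 in l1.
- by right; rewrite e -[in RHS]six !unrotK.
- by left; rewrite e -[in RHS]six !unrotK.
Qed.

Lemma start_inward i : inward i (dv i).
Proof.
have [l0 _] := land i; have := lit l0; rewrite /track advance0 => -[].
exact/lit_inward/dir_vec_unit.
Qed.

Lemma track_last i : track i (len i).-1 + dv i = pmid (sigma i).
Proof. by have [l0 <-] := land i; rewrite /track -advanceS prednK. Qed.

Lemma end_inward i : inward (sigma i) (- dv i).
Proof.
have [l0 _] := land i.
have [|i1 i2] := @lit i (len i).-1; first by rewrite prednK.
apply: lit_inward; first exact/opp_unit/dir_vec_unit.
  by rewrite -track_last -cell_flip.
by rewrite unrot_opp -track_last -cell_next.
Qed.

(** Away from the ends of beam i, the winding number is the same in the three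
    cells on the inner side at the midpoint of a pane. *)
Lemma winding_inner i u E : u != i -> u != sigma i ->
  inward u E \/ E = - pvec u -> winding i (cell (pmid u) E) = (left sigma i u : nat)%:Z.
Proof.
move=> ui usi.
have h1 : winding i (cell (pmid u) (unrot (pvec u))) = (left sigma i u : nat)%:Z.
  by rewrite winding_right_mid (negbTE ui).
have off E' : beam_count i (pmid u, E') = 0.
  by apply: beam_count_off => s sl /(track_mid sl)[] [_ e]; [case/eqP: ui|case/eqP: usi].
have h2 : winding i (cell (pmid u) (unrot (unrot (pvec u)))) = (left sigma i u : nat)%:Z.
  rewrite -h1; apply/esym/winding_agree => //; first exact/unrot_unit/v_adj.
  by apply: inward_not_boundary; left.
have h3 : winding i (cell (pmid u) (unrot (unrot (unrot (pvec u))))) = (left sigma i u : nat)%:Z.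
  rewrite -h2; apply/esym/winding_agree => //; first exact/unrot_unit/unrot_unit/v_adj.
  by apply: inward_not_boundary; right.
by case=> [[] ->|->] //; rewrite -unrot3.
Qed.

(** Winding number of beam i in the cells that border beam u on its left. *)
Definition left_winding i u s := winding i (cell (track u s) (dv u)).

Lemma left_winding_start i u : u != i -> u != sigma i ->
  left_winding i u 0 = (left sigma i u : nat)%:Z.
Proof.
move=> ui usi; rewrite /left_winding /track advance0.
by apply: winding_inner => //; left; apply: start_inward.
Qed.

Lemma left_winding_end i u : sigma u != i -> sigma u != sigma i ->
  left_winding i u (len u).-1 = (left sigma i (sigma u) : nat)%:Z.
Proof.
move=> ui usi; rewrite /left_winding cell_next track_last.
apply: winding_inner => //; rewrite -unrot_opp.
by case: (end_inward u) => ->; [left; right|right; rewrite unrot3].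
Qed.

(** At a lattice point of beam u, the two edges on its left have the directions
    [turnl (ty u)] and minus [turnr (ty u)]; beam i can run only outwards through the
    first and only inwards through the second. *)
Lemma left_winding_step i u s : (s.+1 < len u)%N ->
  left_winding i u s.+1 = left_winding i u s -
    beam_count i (track u s.+1, dir_vec (turnl (ty u))) -
    beam_count i (track u s.+1, - dir_vec (turnr (ty u))).
Proof.
move=> sl; rewrite /left_winding (cell_next (track u s)) /track -advanceS -/(track u s.+1).
have nb E : ~~ on_boundary (track u s.+1) E.
  by apply/negP => /on_boundary_at[k]; have [|? ?] := @avoid u s.+1 k; [exact: sl|case].
have uD := dir_vec_unit (ty u).
have := winding_jump i (track u s.+1) (rot_unit (rot_unit uD)).
have := winding_jump i (track u s.+1) (rot_unit uD).
rewrite !return_count_off // !unrotK rot2_dir_vec rot_dir_vec !subr0 => <- <-.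
by ring.
Qed.

Lemma beam_count_pos i p d : 0 <= beam_count i (p, dir_vec d) /\
  (d <> ty i -> beam_count i (p, dir_vec d) = 0) /\
  (forall s, (s < len i)%N -> d = ty i -> p = track i s -> 0 < beam_count i (p, dir_vec d)).
Proof.
have e s : traversals (track i s, dv i) (p, dir_vec d) = ((track i s, dv i) == (p, dir_vec d) : nat)%:Z.
  rewrite /traversals /=; have -> : (track i s + dv i, - dv i) == (p, dir_vec d) = false.
    by apply/eqP => /pair_equal_spec[_]; case: (ty i); case: (d).
  by rewrite subr0.
split; first by apply: sumr_ge0 => s _; rewrite e.
split=> [nd|s sl -> ->].
  apply: big1 => s _; rewrite e; case: eqP => // /pair_equal_spec[_].
  by case: (ty i) nd; case: (d).
rewrite /beam_count (bigD1 (Ordinal sl)) //= {1}/traversals eqxx.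
have -> : (track i s + dv i, - dv i) == (track i s, dv i) = false.
  by apply/eqP => /pair_equal_spec[_]; case: (ty i).
rewrite subr0 ltr_pwDl // sumr_ge0 // => s' _; rewrite /traversals.
have -> : ((track i s', dv i).1 + (track i s', dv i).2, - (track i s', dv i).2) == (track i s, dv i) = false.
  by apply/eqP => /pair_equal_spec[_]; case: (ty i).
by rewrite subr0.
Qed.

Lemma beam_count_neg i p d : beam_count i (p, - dir_vec d) <= 0 /\
  (d <> ty i -> beam_count i (p, - dir_vec d) = 0) /\
  (forall s, (s < len i)%N -> d = ty i -> p = track i s.+1 -> beam_count i (p, - dir_vec d) < 0).
Proof.
have e s : traversals (track i s, dv i) (p, - dir_vec d) =
    - ((track i s.+1, - dv i) == (p, - dir_vec d) : nat)%:Z.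
  rewrite /traversals /= /track advanceS; have -> : (advance (pmid i) (dv i) s, dv i) == (p, - dir_vec d) = false.
    by apply/eqP => /pair_equal_spec[_]; case: (ty i); case: (d).
  by rewrite sub0r.
have -> : beam_count i (p, - dir_vec d) =
    - \sum_(s < len i) ((track i s.+1, - dv i) == (p, - dir_vec d) : nat)%:Z.
  by rewrite -sumrN; apply: eq_bigr => s _; rewrite e.
split; first by rewrite oppr_le0 sumr_ge0.
split=> [nd|s sl -> ->].
  apply/eqP; rewrite oppr_eq0; apply/eqP/big1 => s _; case: eqP => // /pair_equal_spec[_].
  by case: (ty i) nd; case: (d).
by rewrite oppr_lt0 (bigD1 (Ordinal sl)) //= eqxx ltr_pwDl // sumr_ge0.
Qed.

Lemma left_winding_monotone i u a b : (a <= b)%N -> (b < len u)%N ->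
  [/\ ty u = ty i -> left_winding i u b = left_winding i u a,
      ty u = turnl (ty i) -> left_winding i u a <= left_winding i u b
    & ty u = turnr (ty i) -> left_winding i u b <= left_winding i u a].
Proof.
move=> ab; rewrite -(subnKC ab); elim: (b - a)%N => [|d IH]; first by rewrite addn0.
rewrite addnS => l; have [h1 h2 h3] := IH (ltnW l).
have st := left_winding_step i l.
have [p1 [p2 _]] := beam_count_pos i (track u (a + d).+1) (turnl (ty u)).
have [n1 [n2 _]] := beam_count_neg i (track u (a + d).+1) (turnr (ty u)).
split=> e; rewrite st.
- rewrite p2 ?n2 ?subr0 ?h1 //; rewrite e; case: (ty i) => //.
- rewrite p2; last by rewrite e; case: (ty i).
  by have := h2 e; lia.
- rewrite n2; last by rewrite e; case: (ty i).
  by have := h3 e; lia.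
Qed.

Lemma beams_monotone : monotone_sides sigma ty.
Proof.
move=> i u ui usi sui; have [l0 _] := land u.
have susi : sigma u != sigma i by rewrite (inj_eq perm_inj).
have l1 : ((len u).-1 < len u)%N by rewrite prednK.
have := left_winding_monotone i (leq0n _) l1.
rewrite left_winding_start // left_winding_end //.
case: (left sigma i u); case: (left sigma i (sigma u)) => -[h1 h2 h3]; split=> // e.
all: by move: (h1 e) || move: (h2 e) || move: (h3 e).
Qed.

(** At the crossing, the monotone sequence of [left_winding] changes strictly. *)
Lemma beams_crossing i u a b : u != i -> u != sigma i -> sigma u != i -> ty u <> ty i ->
  (0 < a < len i)%N -> (0 < b < len u)%N -> track i a = track u b ->
  left sigma i u != left sigma i (sigma u).
Proof.
move=> ui usi sui tyn /andP[a0 al] /andP[b0 bl] e; have [l0 _] := land u.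
have susi : sigma u != sigma i by rewrite (inj_eq perm_inj).
have l1 : ((len u).-1 < len u)%N by rewrite prednK.
have bl' : (b.-1 < len u)%N by apply: leq_ltn_trans bl; apply: leq_pred.
have bl1 : (b <= (len u).-1)%N by rewrite -ltnS prednK.
have [_ h2 h3] := left_winding_monotone i (leq0n _) bl'.
have [_ h2' h3'] := left_winding_monotone i bl1 l1.
rewrite left_winding_start // in h2 h3; rewrite left_winding_end // in h2' h3'.
have st : left_winding i u b = left_winding i u b.-1 -
    beam_count i (track u b, dir_vec (turnl (ty u))) -
    beam_count i (track u b, - dir_vec (turnr (ty u))).
  by rewrite -{1 3 4}(prednK b0) left_winding_step // prednK.
have [p1 [p2 /(_ a al) p3]] := beam_count_pos i (track u b) (turnl (ty u)).
have al' : (a.-1 < len i)%N by apply: leq_ltn_trans al; apply: leq_pred.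
have [m1 [m2 /(_ a.-1 al') m3]] := beam_count_neg i (track u b) (turnr (ty u)).
rewrite (prednK a0) in m3.
have [t|t] : ty u = turnl (ty i) \/ ty u = turnr (ty i).
  by move: tyn; case: (ty u); case: (ty i); auto.
  have := h2 t; have := h2' t; rewrite st p2; last by rewrite t; case: (ty i).
  have := m3 _ (esym e); rewrite t; case: (ty i) => /= /(_ erefl);
    case: (left _ _ _); case: (left _ _ _) => //; lia.
have := h3 t; have := h3' t; rewrite st m2; last by rewrite t; case: (ty i).
have := p3 _ (esym e); rewrite t; case: (ty i) => /= /(_ erefl);
    case: (left _ _ _); case: (left _ _ _) => //; lia.
Qed.

(** At the midpoint of the pane j, the two inward directions are minus that of beam i
    and that of beam j, and the order in which they come is the side of the turn.
    After a left turn, beam j has on its left the cell next to the first half of the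
    pane, where the winding number is 1; after a right turn, the cell next to the
    second half, where it is 0.  The monotonicity along beam j carries this
    value to its end. *)
Lemma beams_turn : turns_to_its_side sigma ty.
Proof.
move=> i ki; set j := sigma i in ki *.
have kj : sigma j != j := sigma_moves j; have [l0 _] := land j.
have l1 : ((len j).-1 < len j)%N by rewrite prednK.
have end_ := left_winding_end ki kj.
have [_ h2 h3] := left_winding_monotone i (leq0n _) l1.
have start : left_winding i j 0 = winding i (cell (pmid j) (dv j)).
  by rewrite /left_winding /track advance0.
have op : dv j <> - dv i by case: (ty i); case: (ty j).
have [ej|ej] := start_inward j; have [ei|ei] := end_inward i.
- by case: op; rewrite ej ei.
- right; have t : ty j = turnr (ty i).
    by apply: dir_vec_inj; rewrite -[RHS]opprK -rot_dir_vec -rotN ei rotK.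
  split=> //; have := h3 t; rewrite end_ start ej winding_right_mid (negbTE (sigma_moves i)).
  by rewrite (left_own i).2; case: (left _ _ _).
- left; have t : ty j = turnl (ty i).
    by apply: dir_vec_inj; rewrite -rot2_dir_vec ej -unrot_opp ei.
  split=> //; have := h2 t; rewrite end_ start ej.
  rewrite winding_agree ?unrot3 ?unrot_unit ?v_adj //; last first.
  - apply: big1 => s _; apply: traversals_eq0 => /= /pair_equal_spec[].
      move=> /(track_mid (ltnW (ltn_ord s)))[] [es e'].
        by have := sigma_moves i; rewrite -/j e' eqxx.
      by have := ltn_ord s; rewrite {1}es ltnn.
    by move=> _ e'; apply: op; rewrite ej -e'.
  - by apply: inward_not_boundary; right.
  by rewrite pmidE -cell_flip winding_right_beg eqxx /=; case: (left _ _ _).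
- by case: op; rewrite ej ei.
Qed.

End Beams.
End Panes.
(** * The polygon in the plane *)
Import numFieldNormedType.Exports.
Local Open Scope classical_set_scope.

Section Embedding.
Variable R : realType.
Local Notation s3 := (Num.sqrt (3 : R)).

(** The point with coordinates x, y in the basis of the refined lattice. *)
Definition pt (x y : R) : R * R := (x / 2 + y / 4, y * (s3 / 4)).

Lemma s3_ge1 : 1 <= s3.
Proof. by rewrite -[leLHS]sqrtr1 ler_wsqrtr //; lra. Qed.

Lemma pt_inj x y x' y' : pt x y = pt x' y' -> x = x' /\ y = y'.
Proof.
move=> [e1 e2]; have h := s3_ge1.
have ey : y = y' by apply: (mulIf (x := s3 / 4)) e2; lra.
by split=> //; move: e1; rewrite ey; lra.
Qed.

Lemma grid_pointE (a : vec) : grid_point R a = pt (2 * a.1%:~R) (2 * a.2%:~R).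
Proof. by rewrite /grid_point /pt; congr pair; lra. Qed.

Lemma pt_comb t x y x' y' :
  (1 - t) *: pt x y + t *: pt x' y' = pt ((1 - t) * x + t * x') ((1 - t) * y + t * y').
Proof. by rewrite /pt; congr pair; rewrite /= /GRing.scale /=; lra. Qed.

(** The point w + e E + r (rot E). *)
Definition loc (w E : vec) (e r : R) : R * R :=
  pt (w.1%:~R + e * E.1%:~R - r * E.2%:~R)
     (w.2%:~R + e * E.2%:~R + r * (E.1%:~R + E.2%:~R)).

Definition center (q : vec) : R * R := pt (q.1%:~R / 3) (q.2%:~R / 3).

Lemma center_cell w E : center (cell w E) = loc w E (3^-1) (3^-1).
Proof.
rewrite /center /loc /cell /=; congr pt;
  rewrite !(rmorphD, rmorphB, rmorphM, rmorphN) /=; lra.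
Qed.

Lemma loc_comb t w E e r e' r' : (1 - t) *: loc w E e r + t *: loc w E e' r' =
  loc w E ((1 - t) * e + t * e') ((1 - t) * r + t * r').
Proof. by rewrite /loc pt_comb; congr pt; lra. Qed.

Definition not_int (x : R) := forall z : int, x <> z%:~R.

Lemma not_int_add (a : int) f : 0 < f < 1 -> not_int (a%:~R + f).
Proof.
move=> /andP[f0 f1] z e.
have h1 : (a < z)%R by rewrite -(ltr_int R) -e; lra.
have h2 : (z < a + 1)%R by rewrite -(ltr_int R) -e rmorphD /=; lra.
lia.
Qed.

Lemma not_int_sub (a : int) f : 0 < f < 1 -> not_int (a%:~R - f).
Proof.
move=> /andP[f0 f1]; have -> : a%:~R - f = (a - 1)%:~R + (1 - f) by rewrite rmorphB /=; lra.
by apply: not_int_add; lra.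
Qed.

(** In these coordinates every pane lies on a line where x, y or x + y is an integer. *)
Definition off_lines x y := [/\ not_int x, not_int y & not_int (x + y)].

Lemma off_lines_loc w E e r : E \in unit_vectors -> 0 < e -> 0 < r -> e + r < 1 ->
  off_lines (w.1%:~R + e * E.1%:~R - r * E.2%:~R)
     (w.2%:~R + e * E.2%:~R + r * (E.1%:~R + E.2%:~R)).
Proof.
move=> uE e0 r0 er.
have add (a : int) x : x = a%:~R + e \/ x = a%:~R + r \/ x = a%:~R + (e + r) \/
   x = a%:~R - e \/ x = a%:~R - r \/ x = a%:~R - (e + r) -> not_int x.
  by case=> [|[|[|[|[]]]]] ->; first [by apply: not_int_add; lra | by apply: not_int_sub; lra].
move: uE; rewrite !inE => /or4P[|||/or3P[]] /eqP -> /=; split.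
all: try (by apply: (add w.1); lra); try (by apply: (add w.2); lra).
all: by apply: (add (w.1 + w.2)); rewrite rmorphD /=; lra.
Qed.

End Embedding.

Lemma near_right0_small (R : realType) (P : R -> Prop) (d : R) :
  (\forall t \near 0^'+, P t) -> 0 < d -> exists t, [/\ 0 < t, t < d & P t].
Proof.
move=> nP d0; have : \forall t \near (0 : R)^'+, [/\ 0 < t, t < d & P t].
  near=> t; split; last by near: t.
    by near: t; apply: nbhs_right_gt.
  by near: t; apply: nbhs_right_lt.
exact: filter_ex.
Unshelve. all: by end_near. Qed.

Section Topology.
Variables (R : realType) (P : grid_polygon R).
Local Notation vtx := (@vertex R P).
Local Notation lit z := ((region P)° z).

(** Points of the boundary of P, by [edge_pointP]. *)
Definition edge_point z := region P z /\ ~ lit z.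

Lemma vertex_adj k : vtx (ordS k) - vtx k \in unit_vectors.
Proof. exact: (vertex_adjacent (g := P) k). Qed.

(** A segment is connected, and its points in the interior of P form a relatively open
    and closed subset when it avoids the boundary. *)
Lemma lit_along a b : (forall z, segment a b z -> ~ edge_point z) -> lit a -> lit b.
Proof.
move=> seg la; pose g (t : R) := (1 - t) *: a + t *: b.
have cg : continuous g.
  move=> t; apply: cvgD; apply: cvgZr_tmp; last exact: cvg_id.
  by apply: cvgB; [exact: cvg_cst|exact: cvg_id].
have op (D : set (R * R)) : open D -> open (g @^-1` D).
  by apply: open_comp => ? _; apply: cg.
have clP : closed (region P).
  by apply: compact_closed; [exact: norm_hausdorff|exact: region_compact].
pose I : set R := `[0, 1]; pose B := I `&` g @^-1` (region P)°.
have BE : B = I.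
  apply: (@segment_connected R 0 1).
  - by exists 0; split; rewrite /I /g /= ?in_itv /= ?lexx ?ler01 // subr0 scale1r scale0r addr0.
  - by exists (g @^-1` (region P)°) => //; apply/op/open_interior.
  - exists (~` (g @^-1` (~` region P))).
      by apply/open_closedC/op/closed_openC.
    apply/seteqP; split=> t [It gt]; split=> //=.
      by move: gt => /interior_subset gt; apply.
    apply: contrapT => ng; apply: (seg (g t)); first by exists t.
    by split=> //; apply: contrapT.
have : B 1 by rewrite BE /I /= in_itv /= lexx ler01.
by case=> _; rewrite /g /= subrr scale0r add0r scale1r.
Qed.

Lemma segment_sym (a b : R * R) : segment a b `<=` segment b a.
Proof.
move=> z [t]; rewrite /= in_itv /= => /andP[t0 t1] <-; exists (1 - t) => /=.
  by rewrite in_itv /=; apply/andP; split; lra.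
by rewrite addrC; congr (_ + _); congr (_ *: _); lra.
Qed.

Lemma lit_alongE a b : (forall z, segment a b z -> ~ edge_point z) -> lit a <-> lit b.
Proof. by move=> h; split; apply: lit_along => // z /segment_sym /h. Qed.

Lemma edge_pointP z : edge_point z <-> exists k, exists2 t, 0 <= t <= 1 &
  z = pt (2 * (vtx k).1%:~R + 2 * t * (pvec vtx k).1%:~R)
         (2 * (vtx k).2%:~R + 2 * t * (pvec vtx k).2%:~R).
Proof.
have : (region P `\` (region P)°) z <-> edge_point z by [].
rewrite region_boundary => <-.
have e t k : (1 - t) *: grid_point R (vtx k) + t *: grid_point R (vtx (ordS k)) =
  pt (2 * (vtx k).1%:~R + 2 * t * (pvec vtx k).1%:~R)
         (2 * (vtx k).2%:~R + 2 * t * (pvec vtx k).2%:~R).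
  by rewrite !grid_pointE pt_comb /pvec; congr pt; rewrite /= rmorphB /=; lra.
split=> [[k _ [t /= t01 <-]]|[k [t t01 ->]]].
  by exists k, t; rewrite -?e //; move: t01; rewrite in_itv.
by exists k => //; exists t; rewrite ?e //= in_itv.
Qed.

(** The directions of unoriented panes. *)
Definition axes : seq vec := [:: (1, 0); (0, 1); (-1, 1)].

Lemma edge_point_axis x y : edge_point (pt x y) -> exists b V,
  [/\ V \in axes, on_boundary vtx b V, on_boundary vtx (b + V) V &
  exists2 s : R, 0 <= s <= 2 & x = b.1%:~R + s * V.1%:~R /\ y = b.2%:~R + s * V.2%:~R].
Proof.
move/edge_pointP => [k [t /andP[t0 t1] /pt_inj[-> ->]]].
have bb : on_boundary vtx (pbeg vtx k) (pvec vtx k) by apply/on_boundaryP; exists k; constructor 1.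
have bm : on_boundary vtx (pmid vtx k) (pvec vtx k) by apply/on_boundaryP; exists k; constructor 2.
have bm' : on_boundary vtx (pmid vtx k) (- pvec vtx k) by apply/on_boundaryP; exists k; constructor 3.
have be' : on_boundary vtx (pbeg vtx (ordS k)) (- pvec vtx k) by apply/on_boundaryP; exists k; constructor 4.
have [ax|nax] := boolP (pvec vtx k \in axes).
  exists (pbeg vtx k), (pvec vtx k); split; rewrite -?pmidE //.
  by exists (2 * t); [lra|rewrite /pbeg /= !rmorphD /=; split; lra].
exists (pbeg vtx (ordS k)), (- pvec vtx k); split => //.
- by move: (vertex_adj k) nax; rewrite -/(pvec vtx k) !inE => /or4P[|||/or3P[]] /eqP ->.
- by rewrite pendE addrK.
exists (2 * (1 - t)); first by lra.
by rewrite pendE pmidE /pbeg /= !rmorphN /= !rmorphD /=; split; lra.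
Qed.

Lemma off_lines_not_edge x y : off_lines x y -> ~ edge_point (pt x y).
Proof.
move=> [nx ny nxy] /edge_point_axis[b [V [ax _ _ [s _ [ex ey]]]]].
move: ax; rewrite !inE => /or3P[] /eqP e; rewrite e /= in ex ey.
- by apply: (ny b.2); lra.
- by apply: (nx b.1); lra.
- by apply: (nxy (b.1 + b.2)); rewrite rmorphD /=; lra.
Qed.

Lemma triangle_not_edge w E e r : E \in unit_vectors -> 0 < e -> 0 < r -> e + r < 1 ->
  ~ edge_point (loc w E e r).
Proof. by move=> *; apply/off_lines_not_edge/off_lines_loc. Qed.

Lemma int_half_shift (w b : int) (s : R) : w%:~R + 2^-1 = b%:~R + s -> 0 <= s <= 2 ->
  w = b \/ w = b + 1.
Proof.
move=> e /andP[s0 s2].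
have h1 : (b < w + 1)%R by rewrite -(ltr_int R) rmorphD /=; lra.
have h2 : (w < b + 2)%R by rewrite -(ltr_int R) rmorphD /=; lra.
lia.
Qed.

Lemma mid_edge_on_boundary w E : E \in unit_vectors ->
  edge_point (loc w E (2^-1 : R) 0) -> on_boundary vtx w E.
Proof.
wlog ax : w E / E \in axes => [H|] uE.
  have [ax|nax] := boolP (E \in axes); first exact: H.
  have -> : loc w E (2^-1 : R) 0 = loc (w + E) (- E) (2^-1 : R) 0.
    by rewrite /loc /= !rmorphN !rmorphD /=; congr pt; lra.
  move=> ep; rewrite on_boundary_rev; apply: (H _ _ _ (opp_unit uE) ep).
  by move: uE nax; rewrite !inE => /or4P[|||/or3P[]] /eqP ->.
move=> /edge_point_axis[b [V [axV b1 b2 [s s02 [ex ey]]]]].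
have half (a c : int) : a%:~R + 2^-1 = c%:~R :> R -> False.
  by apply: not_int_add; lra.
have half' (a c : int) : a%:~R - 2^-1 = c%:~R :> R -> False.
  by apply: not_int_sub; lra.
case: w ex ey => w1 w2 /= ex ey; case: b b1 b2 ex ey => c1 c2 b1 b2 /= ex ey.
have same : V = E -> w1%:~R + 2^-1 * E.1%:~R = c1%:~R + s * E.1%:~R :> R ->
     w2%:~R + 2^-1 * E.2%:~R = c2%:~R + s * E.2%:~R :> R -> on_boundary vtx (w1, w2) E.
  move=> eV e1 e2; rewrite eV in b1 b2.
  suff : (w1, w2) = (c1, c2) \/ (w1, w2) = (c1, c2) + E by case=> ->.
  move: ax e1 e2; rewrite !inE => /or3P[] /eqP -> /= e1 e2.
  - have e : w2 = c2 by apply/eqP; rewrite -(eqr_int R); apply/eqP; lra.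
    have [->|->] : w1 = c1 \/ w1 = c1 + 1 by apply: (@int_half_shift _ _ s) => //; lra.
      by left; rewrite e.
    by right; rewrite e; congr pair => /=; lia.
  - have e : w1 = c1 by apply/eqP; rewrite -(eqr_int R); apply/eqP; lra.
    have [->|->] : w2 = c2 \/ w2 = c2 + 1 by apply: (@int_half_shift _ _ s) => //; lra.
      by left; rewrite e.
    by right; rewrite e; congr pair => /=; lia.
  - have e : w1 + w2 = c1 + c2 by apply/eqP; rewrite -(eqr_int R) !rmorphD /=; apply/eqP; lra.
    have [e'|e'] : w2 = c2 \/ w2 = c2 + 1 by apply: (@int_half_shift _ _ s) => //; lra.
      by left; congr pair; lia.
    by right; congr pair => /=; lia.
move: ax axV ex ey same; rewrite !inE => /or3P[] /eqP -> /or3P[] /eqP -> /= ex ey same.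
1,5,9: by apply: same; rewrite ?mulr0 ?mul0r ?addr0 ?subr0 // -?ex -?ey; lra.
all: exfalso; clear same b1 b2.
all: try (by apply: (half w1 c1); lra); try (by apply: (half w2 c2); lra).
all: try (by apply: (half' w1 c1); lra).
all: by apply: (half (w1 + w2) (c1 + c2)); rewrite !rmorphD /=; lra.
Qed.

(** A cell is represented by its centroid, as the boundary does not enter its
    interior. *)
Definition inside (q : vec) : bool := `[< lit (center R q) >].

Lemma comb_gt0 (t a b : R) : 0 <= t <= 1 -> 0 < a -> 0 < b -> 0 < (1 - t) * a + t * b.
Proof. by move=> /andP[t0 t1] a0 b0; nra. Qed.

Lemma lit_triangle w E e r : E \in unit_vectors -> 0 < e -> 0 < r -> e + r < 1 ->
  lit (loc w E e r) <-> inside (cell w E).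
Proof.
move=> uE e0 r0 er; rewrite /inside asboolE center_cell.
apply: lit_alongE => z [t]; rewrite /= in_itv /= => t01 <-; rewrite loc_comb.
apply: triangle_not_edge => //; try (apply: comb_gt0 => //; lra).
rewrite -subr_gt0 (_ : _ - _ = (1 - t) * (1 - e - r) + t * 3^-1); last by lra.
by apply: comb_gt0 => //; lra.
Qed.

Lemma lit_mid w E : E \in unit_vectors -> ~ edge_point (loc w E (2^-1 : R) 0) ->
  lit (loc w E 2^-1 0) <-> inside (cell w E).
Proof.
move=> uE ne; rewrite /inside asboolE center_cell.
apply: lit_alongE => z [t]; rewrite /= in_itv /= => /andP[t0 t1] <-; rewrite loc_comb.
have [->|nt] := eqVneq t 0; first by rewrite subr0 !mul1r !mul0r !addr0.
have {}t0 : 0 < t by rewrite lt_neqAle eq_sym nt.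
by apply: triangle_not_edge => //; nra.
Qed.

Lemma mid_rev w E : loc w E (2^-1 : R) 0 = loc (w + E) (- E) 2^-1 0.
Proof. by rewrite /loc /= !rmorphN !rmorphD /=; congr pt; lra. Qed.

Lemma lit_mid_right w E : E \in unit_vectors -> ~ edge_point (loc w E (2^-1 : R) 0) ->
  lit (loc w E 2^-1 0) <-> inside (cell w (unrot E)).
Proof. by move=> uE ne; rewrite cell_flip mid_rev; apply: lit_mid; rewrite ?opp_unit -?mid_rev. Qed.

Lemma polygon_sides_agree : sides_agree vtx inside.
Proof.
move=> w E uE nb; have ne : ~ edge_point (loc w E (2^-1 : R) 0).
  by move=> /(mid_edge_on_boundary uE); apply/negP.
apply/idP/idP => h.
  by apply/(lit_mid_right uE ne)/(lit_mid uE ne).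
by apply/(lit_mid uE ne)/(lit_mid_right uE ne).
Qed.

Lemma loc_below w E (e r : R) : loc w E e r = loc w (unrot E) (- r) (e + r).
Proof. by rewrite /loc /=; congr pt; rewrite !(rmorphN, rmorphD) /=; lra. Qed.

(** Coordinates around the midpoint of an edge; E being a unit vector, its rotation
    gives the inverse matrix. *)
Lemma ball_loc (w E : vec) (z : R * R) : E \in unit_vectors ->
  `|(loc w E (2^-1 : R) 0).1 - z.1| < 100^-1 -> `|(loc w E (2^-1 : R) 0).2 - z.2| < 100^-1 ->
  exists a b : R, [/\ z = loc w E (2^-1 + a) b, `|a| < 8^-1 & `|b| < 8^-1].
Proof.
move=> uE; have h := s3_ge1 R; have s0 : Num.sqrt 3 != 0 :> R by lra.
rewrite !ltr_norml; case: z => z1 z2 /=; set m1 := _ / 2 + _; set m2 := _ * (_ / 4).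
pose y := z2 * (4 / Num.sqrt 3); pose x := 2 * z1 - y / 2.
have zE : (z1, z2) = pt x y.
  by rewrite /pt /x /y; congr pair; [lra|field].
pose dx := x - (w.1%:~R + 2^-1 * E.1%:~R); pose dy := y - (w.2%:~R + 2^-1 * E.2%:~R).
have e2 : m2 - z2 = - dy * (Num.sqrt 3 / 4) by rewrite /m2 /dy /y; field.
have e1 : m1 - z1 = - dx / 2 - dy / 4 by rewrite /m1 /dx /dy /x; lra.
rewrite e1 e2 => /andP[l1 l2] /andP[l3 l4].
have b2 : - 25^-1 < dy < 25^-1 by apply/andP; split; nra.
have b1 : - 24^-1 < dx < 24^-1 by lra.
exists (dx * (E.1%:~R + E.2%:~R) + dy * E.2%:~R), (E.1%:~R * dy - E.2%:~R * dx).
rewrite zE /loc !ltr_norml /dx /dy; clearbody x y; move: uE b1 b2; rewrite /dx /dy; clear.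
rewrite !inE => /or4P[|||/or3P[]] /eqP -> /= b1 b2;
  (split; [by congr pt; lra | by lra | by lra]).
Qed.

(** If both sides of a boundary edge were inside, a neighbourhood of its midpoint would
    lie in P. *)
Lemma edge_not_between w E : E \in unit_vectors ->
  (forall e : R, 0 <= e <= 1 -> edge_point (loc w E e 0)) ->
  inside (cell w E) -> ~~ inside (cell w (unrot E)).
Proof.
move=> uE edge il; apply/negP => ir.
have [] : edge_point (loc w E 2^-1 0) by apply: edge; lra.
move=> _; apply; apply/nbhs_ballP; exists 100^-1 => /=; first by lra.
move=> z [/= b1 b2]; have [a [b [-> ]]] := ball_loc uE b1 b2.
rewrite !ltr_norml => ha hb.
have [b0|b0|<-] := ltgtP 0 b.
- by apply: interior_subset; apply/(lit_triangle w uE) => //; lra.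
- rewrite loc_below; apply: interior_subset; apply/(lit_triangle w (unrot_unit uE)) => //; lra.
- by case: (edge (2^-1 + a)) => //; lra.
Qed.

Lemma edge_point_beg k (e : R) : 0 <= e <= 1 -> edge_point (loc (pbeg vtx k) (pvec vtx k) e 0).
Proof.
move=> e01; apply/edge_pointP; exists k, (e / 2); first by lra.
by rewrite /loc /pbeg /= !rmorphD /=; congr pt; lra.
Qed.

Lemma edge_point_mid k (e : R) : 0 <= e <= 1 -> edge_point (loc (pmid vtx k) (pvec vtx k) e 0).
Proof.
move=> e01; apply/edge_pointP; exists k, ((1 + e) / 2); first by lra.
by rewrite /loc pmidE /pbeg /= !rmorphD /=; congr pt; lra.
Qed.

Lemma s3_sqr : Num.sqrt 3 * Num.sqrt 3 = 3 :> R.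
Proof. by rewrite -expr2 sqr_sqrtr //; lra. Qed.

Lemma midpointE k : midpoint (grid_point R (vtx k)) (grid_point R (vtx (ordS k))) =
  pt (pmid vtx k).1%:~R (pmid vtx k).2%:~R.
Proof.
rewrite /midpoint !grid_pointE /pt /pmid /=; congr pair; rewrite /= /GRing.scale /= !rmorphD /=; lra.
Qed.

(** The right normal of a pane points to the centroid of the middle one of the three
    cells on the right of its midpoint. *)
Lemma right_normalE k (t : R) :
  midpoint (grid_point R (vtx k)) (grid_point R (vtx (ordS k))) +
  t *: right_normal (grid_point R (vtx (ordS k)) - grid_point R (vtx k)) =
  loc (pmid vtx k) (unrot (unrot (pvec vtx k))) (2 * t * Num.sqrt 3 / 3) (2 * t * Num.sqrt 3 / 3).
Proof.
have s := s3_sqr; rewrite midpointE !grid_pointE /loc /right_normal /pt /unrot /pvec /=.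
congr pair; rewrite /= /GRing.scale /= !(rmorphN, rmorphD, rmorphB) /=; first by clear; lra.
set a := (vtx k).1%:~R; set b := (vtx k).2%:~R; set c := (vtx (ordS k)).1%:~R.
set d := (vtx (ordS k)).2%:~R; set q := Num.sqrt 3 in s *.
have h x : t * q * q * x = t * 3 * x by rewrite -(mulrA t) s.
by have := (h a, h b, h c, h d); clear => -[[[]]] *; lra.
Qed.

Lemma polygon_inside_on_right : inside_on_right vtx inside.
Proof.
move=> k; have uV : pvec vtx k \in unit_vectors := vertex_adj k.
have uV1 := unrot_unit uV; have uV2 := unrot_unit uV1.
have r3 : inside (cell (pmid vtx k) (unrot (unrot (pvec vtx k)))).
  (* Below 1/8, the point on the normal lies in the middle cell. *)
  have d0 : 0 < 8^-1 :> R by lra.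
  have [t [t0 t1]] := near_right0_small (region_clockwise (g := P) k) d0.
  rewrite right_normalE; set c := _ / 3 => lt.
  have c0 : 0 < c by rewrite /c; have := s3_ge1 R; nra.
  have c1 : c + c < 1 by rewrite /c; have := s3_ge1 R; have := s3_sqr; nra.
  exact/(lit_triangle (pmid vtx k) uV2 c0 c0 c1).
have nb1 : ~~ on_boundary vtx (pmid vtx k) (unrot (pvec vtx k)).
  by apply: (inward_not_boundary (npanes_ge3 P) (@vertex_inj R P) vertex_adj); left.
have nb2 : ~~ on_boundary vtx (pmid vtx k) (unrot (unrot (pvec vtx k))).
  by apply: (inward_not_boundary (npanes_ge3 P) (@vertex_inj R P) vertex_adj); right.
have r2 : inside (cell (pmid vtx k) (unrot (pvec vtx k))).
  by rewrite polygon_sides_agree.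
have r1 : inside (cell (pbeg vtx k) (unrot (pvec vtx k))).
  by rewrite cell_flip -pmidE -unrot3 -polygon_sides_agree.
split=> //; apply/negP => il.
  by have := edge_not_between uV (edge_point_beg k) il; rewrite r1.
by have := edge_not_between uV (edge_point_mid k) il; rewrite r2.
Qed.

Lemma polygon_inside_bounded : inside_bounded inside.
Proof.
have /compact_bounded[M [_ hM]] := region_compact (g := P).
have {}hM z : region P z -> `|z| <= `|M| + 1 by apply: hM; have := ler_norm M; lra.
pose B := Num.ceil (12 * (`|M| + 1)).
exists (- B) => q qB; apply/negP => /asboolP/interior_subset/hM.
rewrite prod_normE /= ge_max => /andP[_]; rewrite ler_norml => /andP[h _].
have hB : 12 * (`|M| + 1) <= B%:~R by exact: ceil_ge.
have hq : q.2%:~R < - B%:~R :> R by rewrite -rmorphN ltr_int.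
have := s3_ge1 R; have := normr_ge0 M; nra.
Qed.
End Topology.

(** * The beams of the polygon as lattice paths *)
Section Trajectories.
Variables (R : realType) (P : grid_polygon R) (sigma : {perm 'I_(npanes P)}).
Hypothesis bil : billiards_permutation sigma.
Local Notation vtx := (@vertex R P).
Local Notation lit z := ((region P)° z).
Local Notation midp := (@pane_mid R P).

Definition real_track i d (s : R) : R * R :=
  pt ((pmid vtx i).1%:~R + s * (dir_vec d).1%:~R) ((pmid vtx i).2%:~R + s * (dir_vec d).2%:~R).

Lemma real_track_nat i d (s : nat) : real_track i d s%:R =
  pt (advance (pmid vtx i) (dir_vec d) s).1%:~R (advance (pmid vtx i) (dir_vec d) s).2%:~R.
Proof. by rewrite /real_track /advance /= !rmorphD !rmorphM. Qed.

Lemma pane_midE i : midp i = pt (pmid vtx i).1%:~R (pmid vtx i).2%:~R.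
Proof. exact: midpointE. Qed.

(** A beam is a whole number of lattice edges long, because both its ends are lattice
    points and its direction has a coordinate equal to 1 or -1. *)
Lemma beam_track i : exists dl : dir * nat, [/\ (0 < dl.2)%N,
  advance (pmid vtx i) (dir_vec dl.1) dl.2 = pmid vtx (sigma i) &
  forall s, 0 < s < dl.2%:R -> lit (real_track i dl.1 s)].
Proof.
have [d [[dE _ _] [t [_ t0 e lt _]]]] := bil i.
have [d' d'E] : exists d', forall s, midp i + s *: d = real_track i d' (2 * s).
  case: dE => [|[]] ->; [exists NE|exists SE|exists West] => s; rewrite pane_midE /pt /real_track;
    congr pair; rewrite /= /GRing.scale /=; lra.
have int_len (a b : int) : a%:~R = b%:~R + 2 * t -> 2 * t = `|a - b|%N%:R.
  move=> ab; have e' : (a - b)%:~R = 2 * t by rewrite rmorphB /= ab addrAC subrr add0r.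
  have ge0 : (0 <= a - b)%R by rewrite -(ler_int R) e'; lra.
  by rewrite -e' natr_absz ger0_norm.
have [N eN] : exists N : nat, 2 * t = N%:R.
  move: e; rewrite d'E !pane_midE => /pt_inj[e1 e2]; case: (d') e1 e2 => /= e1 e2.
  - by eexists; apply: (@int_len (pmid vtx (sigma i)).2 (pmid vtx i).2) => /=; lra.
  - by eexists; apply: (@int_len (pmid vtx i).1 (pmid vtx (sigma i)).1) => /=; lra.
  - by eexists; apply: (@int_len (pmid vtx (sigma i)).1 (pmid vtx i).1) => /=; lra.
exists (d', N); split=> /=.
- by rewrite -(ltr_nat R) -eN; lra.
- move: e; rewrite d'E eN real_track_nat pane_midE => /pt_inj[/eqP + /eqP].
  rewrite !eqr_int => /eqP e1 /eqP e2; move: e1 e2.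
  by case: (pmid _ _) (advance _ _ _) => [a b] [a' b'] /= -> ->.
move=> s /andP[s0 sN]; have -> : s = 2 * (s / 2) by lra.
by rewrite -d'E; apply: lt; apply/andP; split; lra.
Qed.

Lemma sigma_moves_pane i : sigma i != i.
Proof. by have [d [_ [t []]]] := bil i. Qed.

Section Tracks.
Variable tl : 'I_(npanes P) -> dir * nat.
Hypothesis tlP : forall i, [/\ (0 < (tl i).2)%N,
  advance (pmid vtx i) (dir_vec (tl i).1) (tl i).2 = pmid vtx (sigma i) &
  forall s, 0 < s < (tl i).2%:R -> lit (real_track i (tl i).1 s)].
Local Notation ty i := (tl i).1.
Local Notation len i := (tl i).2.

Lemma edge_point_pmid k : edge_point P (pt (pmid vtx k).1%:~R (pmid vtx k).2%:~R).
Proof. by have := @edge_point_mid R P k 0; rewrite /loc !mul0r !addr0 subr0; apply; rewrite lexx ler01. Qed.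

Lemma edge_point_pbeg k : edge_point P (pt (pbeg vtx k).1%:~R (pbeg vtx k).2%:~R).
Proof. by have := @edge_point_beg R P k 0; rewrite /loc !mul0r !addr0 subr0; apply; rewrite lexx ler01. Qed.

Lemma tracks_land : beams_land vtx sigma (fun i => ty i) (fun i => len i).
Proof. by move=> i; have [] := tlP i. Qed.

Lemma tracks_inside : beams_inside vtx (inside P) (fun i => ty i) (fun i => len i).
Proof.
move=> i s sl; have [_ _ l] := tlP i.
have uD := dir_vec_unit (ty i).
have sl' : (s.+1%:R : R) <= (len i)%:R by rewrite ler_nat.
have {l} : lit (real_track i (ty i) (s%:R + 2^-1)).
  apply: l; rewrite -natr1 in sl'; have := ler0n R s; lra.
have -> : real_track i (ty i) (s%:R + 2^-1) = loc (track vtx (fun i => ty i) i s) (dir_vec (ty i)) 2^-1 0.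
  by rewrite /real_track /loc /track /advance /= !rmorphD !rmorphM /=; congr pt; lra.
move=> l; have ne : ~ edge_point P (loc (track vtx (fun i => ty i) i s) (dir_vec (ty i)) (2^-1 : R) 0).
  by case.
by split; [apply/(lit_mid uD ne)|apply/(lit_mid_right uD ne)].
Qed.

Lemma tracks_avoid : beams_avoid_boundary vtx (fun i => ty i) (fun i => len i).
Proof.
move=> i s k sl; have [_ _ l] := tlP i.
have {l} : lit (real_track i (ty i) s%:R) by apply: l; rewrite ltr0n ltr_nat.
rewrite real_track_nat -/(track vtx (fun i => ty i) i s) => l.
by split=> e; rewrite e in l; [case: (edge_point_pmid k)|case: (edge_point_pbeg k)].
Qed.

Lemma pane_mid_inj : injective midp.
Proof.
move=> k l; rewrite !pane_midE => /pt_inj[/eqP + /eqP]; rewrite !eqr_int => /eqP e1 /eqP e2.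
apply: (pmid_inj (npanes_ge3 P) (@vertex_inj R P) (@vertex_adj R P)).
by move: e1 e2; case: (pmid _ k) (pmid _ l) => [a b] [a' b'] /= -> ->.
Qed.

Lemma real_track0 i : real_track i (ty i) 0 = midp i.
Proof. by rewrite /real_track pane_midE !mul0r !addr0. Qed.

Lemma real_track_len i : real_track i (ty i) (len i)%:R = midp (sigma i).
Proof. by have [_ e _] := tlP i; rewrite real_track_nat e pane_midE. Qed.

Lemma segment_track i z : segment (midp i) (midp (sigma i)) z ->
  exists2 s : R, 0 <= s <= (len i)%:R & z = real_track i (ty i) s.
Proof.
case=> t; rewrite /= in_itv /= => /andP[t0 t1] <-; exists (t * (len i)%:R).
  by have := ler0n R (len i); nra.
by rewrite -real_track0 -real_track_len /real_track pt_comb; congr pt; lra.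
Qed.

Lemma track_dark i s : 0 <= s <= (len i)%:R -> ~ lit (real_track i (ty i) s) ->
  real_track i (ty i) s = midp i \/ real_track i (ty i) s = midp (sigma i).
Proof.
move=> /andP[s0 sl] dark; have [_ _ l] := tlP i.
have [->|n0] := eqVneq s 0; first by left; rewrite real_track0.
have [->|nl] := eqVneq s (len i)%:R; first by right; rewrite real_track_len.
by case: dark; apply: l; rewrite !lt_neqAle eq_sym n0 s0 nl sl.
Qed.

Lemma mid_dark i : ~ lit (midp i).
Proof. by rewrite pane_midE; case: (edge_point_pmid i). Qed.

(** The ends of a beam are on the boundary, the rest of it is inside; so an end can
    meet another beam only at one of its ends, which is then the same pane. *)
Lemma track_interior i u s s' : u != i -> u != sigma i -> sigma u != i ->
  0 <= s <= (len i)%:R -> 0 <= s' <= (len u)%:R ->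
  real_track i (ty i) s = real_track u (ty u) s' -> 0 < s < (len i)%:R.
Proof.
move=> ui usi sui hs hs' e.
have no k : k = i \/ k = sigma i -> real_track i (ty i) s <> midp k.
  move=> hk ek; have := @mid_dark k; rewrite -ek e => /(track_dark hs').
  rewrite -e ek => -[] /pane_mid_inj ku; case: hk => ki; rewrite ku in ki.
  - by rewrite ki eqxx in ui.
  - by rewrite ki eqxx in usi.
  - by rewrite ki eqxx in sui.
  - by rewrite (perm_inj ki) eqxx in ui.
case/andP: hs => s0 sl; rewrite !lt_neqAle s0 sl !andbT; apply/andP; split.
  by apply/eqP => e0; apply: (no i); [left|rewrite -e0 real_track0].
by apply/eqP => e0; apply: (no (sigma i)); [right|rewrite e0 real_track_len].
Qed.

(** Two parallel beams with a common point are on the same line, and one of them would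
    start in the interior of the other. *)
Lemma meeting_types i u s s' : u != i -> u != sigma i -> sigma u != i ->
  0 < s < (len i)%:R -> 0 < s' < (len u)%:R ->
  real_track i (ty i) s = real_track u (ty u) s' -> ty u <> ty i.
Proof.
move=> ui usi sui /andP[s0 sl] /andP[s'0 sl'] e et.
have [_ _ li] := tlP i; have [_ _ lu] := tlP u.
move: e; rewrite et => /pt_inj[e1 e2].
have [l|l|es] := ltgtP s s'.
- have e : midp i = real_track u (ty u) (s' - s).
    by rewrite et pane_midE /real_track; congr pt; lra.
  by apply: (@mid_dark i); rewrite e; apply: lu; lra.
- have e : midp u = real_track i (ty i) (s - s').
    by rewrite pane_midE /real_track; congr pt; lra.
  by apply: (@mid_dark u); rewrite e; apply: li; lra.
case/eqP: ui; apply: pane_mid_inj; rewrite !pane_midE; congr pt; move: e1 e2; rewrite es; lra.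
Qed.

(** Lines of the lattice with different directions meet at a lattice point. *)
Lemma meeting_integral i u s s' : ty u <> ty i ->
  real_track i (ty i) s = real_track u (ty u) s' ->
  exists a b : int, s = a%:~R /\ s' = b%:~R.
Proof.
move=> n /pt_inj[]; set m := pmid vtx i; set m' := pmid vtx u; move=> e1 e2.
case ei: (ty i) n e1 e2 => n; case eu: (ty u) n => // _ /= e1 e2.
- exists (m'.2 - m.2), (m'.1 - m.1); rewrite !rmorphB /=; split; lra.
- exists (m'.2 - m.2 - (m.1 - m'.1)), (m.1 - m'.1); rewrite !rmorphB /=; split; lra.
- exists (m.1 - m'.1), (m.2 - m'.2); rewrite !rmorphB /=; split; lra.
- exists (m.1 - m'.1 - (m'.2 - m.2)), (m'.2 - m.2); rewrite !rmorphB /=; split; lra.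
- exists (m'.1 - m.1), (m.2 - m'.2 - (m'.1 - m.1)); rewrite !rmorphB /=; split; lra.
- exists (m.2 - m'.2), (m'.1 - m.1 - (m.2 - m'.2)); rewrite !rmorphB /=; split; lra.
Qed.

Lemma segments_cross i u : u != i -> u != sigma i -> sigma u != i ->
  segment (midp i) (midp (sigma i)) `&` segment (midp u) (midp (sigma u)) !=set0 ->
  left sigma i u != left sigma i (sigma u).
Proof.
move=> ui usi sui [z [/segment_track[s hs ->] /segment_track[s' hs' e]]].
have h := track_interior ui usi sui hs hs' e.
have h' : 0 < s' < (len u)%:R.
  apply: (track_interior _ _ _ hs' hs (esym e)); rewrite eq_sym //.
have tyn := meeting_types ui usi sui h h' e.
have [a [b [ea eb]]] := meeting_integral tyn e.
have nat_of (x : int) (N : nat) : (0 : R) < x%:~R < N%:R -> exists2 k : nat, (0 < k < N)%N & x = k%:Z.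
  case: x => k; first by rewrite ltr0n ltr_nat => ?; exists k.
  by rewrite ltr0z.
rewrite ea in h e; rewrite eb in h' e.
have [a' ha ea'] := nat_of _ _ _ h; have [b' hb eb'] := nat_of _ _ _ h'.
apply: (beams_crossing (npanes_ge3 P) (@vertex_inj R P) (@vertex_adj R P)
  (@polygon_sides_agree R P) (@polygon_inside_on_right R P) (@polygon_inside_bounded R P)
  tracks_land tracks_inside tracks_avoid ui usi sui tyn ha hb).
move: e; rewrite ea' eb' !real_track_nat => /pt_inj[/eqP + /eqP]; rewrite !eqr_int => /eqP e1 /eqP e2.
by move: e1 e2; rewrite /track; case: (advance _ _ a') (advance _ _ b') => [x y] [x' y'] /= -> ->.
Qed.

Lemma tracks_monotone : monotone_sides sigma (fun i => ty i).
Proof.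
exact: (beams_monotone (npanes_ge3 P) (@vertex_inj R P) (@vertex_adj R P)
  (@polygon_sides_agree R P) (@polygon_inside_on_right R P) (@polygon_inside_bounded R P)
  tracks_land tracks_inside tracks_avoid).
Qed.

Lemma tracks_turn : turns_to_its_side sigma (fun i => ty i).
Proof.
exact: (beams_turn (npanes_ge3 P) (@vertex_inj R P) (@vertex_adj R P)
  (@polygon_sides_agree R P) (@polygon_inside_on_right R P) (@polygon_inside_bounded R P)
  tracks_land tracks_inside tracks_avoid).
Qed.
End Tracks.
End Trajectories.

(** * The trajectories that meet a given one *)
Lemma card_image_of_ord (T : Type) (A : set T) (m : nat) (g : 'I_m -> T) :
  A `<=` range g -> exists2 k : nat, (k <= m)%N & (A #= `I_k)%card.
Proof.
move=> Ag; have Am : (A #<= `I_m)%card.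
  rewrite (card_le_eqr card_II); apply: card_le_trans (subset_card_le Ag) _.
  exact: card_image_le.
have /finite_setP[k Ak] : finite_set A by apply/finite_set_leP; exists m.
by exists k => //; rewrite -card_le_II -(card_le_eql Ak).
Qed.

Section CrossedTriangles.
Variables (n : nat) (sigma : {perm 'I_n}) (ty : 'I_n -> dir) (c : {set 'I_n}).
Hypotheses (side : monotone_sides sigma ty) (turn : turns_to_its_side sigma ty).
Hypotheses (moved : forall x, sigma x != x) (cP : c \in porbits sigma).

Definition crossed_by (c' : {set 'I_n}) := exists i u,
  [/\ i \in c', u \in c & left sigma i u != left sigma i (sigma u)].

Definition crossed_triangles : {set {set 'I_n}} :=
  [set c' in porbits sigma | [&& #|c'| == 3%N, c' != c & `[< crossed_by c' >]]].

Lemma card_crossed_orbits : (#|crossed_triangles| + 2 <= #|c|)%N.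
Proof.
have tri (x : {c' | c' \in crossed_triangles}) : exists st : bool * (dir -> 'I_n),
    [/\ triangle sigma ty st.1 st.2, forall d, st.2 d \in val x &
        forall y, y \in val x -> exists d, y = st.2 d].
  have := valP x; rewrite inE => /and4P[xP /eqP x3 _ _].
  by have [s [t tP]] := triangle_of_orbit turn moved xP x3; exists (s, t).
have [st stP] := fin_all_exists tri.
have orb (x : {c' | c' \in crossed_triangles}) : val x \in porbits sigma /\ val x != c.
  by have := valP x; rewrite inE => /and4P[].
have [r0 r0c] : exists r, r \in c.
  by case/imsetP: cP => r _ ->; exists r; apply: porbit_id.
case: (arg_minnP (fun z : 'I_n => z : nat) r0c) => r rc rmin.
have := card_sig (mem crossed_triangles); rewrite -[RHS]/#|crossed_triangles| => <-.
apply: (card_crossed_triangles side turn (s := fun x => (st x).1) (t := fun x => (st x).2) cP rc rmin) => //.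
- by move=> x; have [] := stP x.
- move=> x d; have [_ /(_ d) tx _] := stP x; apply/negP => tc; have [xP /eqP[]] := orb x.
  by rewrite (orbit_porbit xP tx) (orbit_porbit cP tc).
- move=> x; have := valP x; rewrite inE => /and4P[_ _ _ /asboolP[i [u [ix uc lu]]]].
  by have [_ _ /(_ i ix)[d ei]] := stP x; exists u, d; rewrite -ei.
move=> x y xy d e ede; have [xP _] := orb x; have [yP _] := orb y.
have [_ /(_ d) tx _] := stP x; have [_ /(_ e) ty' _] := stP y.
case/eqP: xy; apply: val_inj; rewrite /= (orbit_porbit xP tx) (orbit_porbit yP ty').
by rewrite /= ede.
Qed.
End CrossedTriangles.

Local Open Scope card_scope.

Theorem theorem1p5 (R : realType) (P : grid_polygon R)
    (sigma : {perm 'I_(npanes P)}) (c : {set 'I_(npanes P)}) (m : nat) :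
  billiards_permutation sigma ->
  c \in porbits sigma -> #|c| = m ->
  exists2 k : nat, (k + 2 <= m)%N &
    [set T | [/\ triangular_trajectory sigma T,
                 m = 3%N -> T <> trajectory sigma c
               & T `&` trajectory sigma c !=set0]] #= `I_k.
Proof.
move=> bil cP cm; have [tl tlP] := fin_all_exists (beam_track bil).
pose F := crossed_triangles sigma c.
have FP : (#|F| + 2 <= m)%N.
  rewrite -cm; apply: (card_crossed_orbits (tracks_monotone tlP) (tracks_turn tlP)) => //.
  exact: sigma_moves_pane.
have [|k kF Sk] := @card_image_of_ord _ [set T | [/\ triangular_trajectory sigma T,
    m = 3%N -> T <> trajectory sigma c & T `&` trajectory sigma c !=set0]] #|F|
    (fun j => trajectory sigma (enum_val j)).
  move=> T [[c' [c'P c'3 ->]] ne [z [[i ic' zi] [u uc zu]]]].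
  have c'c : c' != c by apply/eqP => e; apply: ne; rewrite ?e // -cm -e.
  have apart_orbits x y : x \in c' -> y \in c -> y != x.
    move=> xc' yc; apply: contraNneq c'c => e; rewrite e in yc.
    by rewrite (orbit_porbit c'P xc') (orbit_porbit cP yc).
  have c'F : c' \in F.
    rewrite inE c'P c'3 c'c /=; apply/asboolP; exists i, u; split=> //.
    apply: (segments_cross tlP); last by exists z.
    - exact: apart_orbits.
    - by apply: apart_orbits => //; apply: orbit_step.
    - by apply: apart_orbits => //; apply: orbit_step.
  by exists (enum_rank_in c'F c') => //; rewrite enum_rankK_in.
by exists k => //; apply: leq_trans FP; rewrite leq_add2r.
Qed.
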